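(* Let $n\ge 1$, $M=\mathbb{R}^n$ with the Euclidean metric $g$, and $f(y)=\frac14\lVert y\rVert^2$. Then for every $\varepsilon>0$ there exists a nonzero $v\in L^2(e^{-f}\,dy)$ such that $$\lim_{t\to\infty}e^{-nt/4}\,\lVert P_tv\rVert_{L^2\left(e^{-\frac{f}{\frac12(e^t+1)}}dy\right)}$$ exists and is at least $(1-\varepsilon)\lVert v\rVert_{L^2(e^{-f}dy)}$.
   Context: $P_t=e^{t\Delta_f}$ ($t\ge0$) is the semigroup on $L^2(\mathbb{R}^n,e^{-f}dy)$ generated by the drift Laplacian $\Delta_fv=\Delta v-\frac12\,y\cdot\nabla v$ (with $f=\frac14\lVert y\rVert^2$); thus $v(t,y)=(P_tv_0)(y)$ is the $L^2(e^{-f}dy)$ solution of $\partial_tv=\Delta_fv$ with initial condition $v_0$. *)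

(* Defs.v *)
From HB Require Import structures.
From mathcomp Require Import all_boot all_order all_algebra.
From mathcomp Require Import all_classical all_reals all_analysis.
From mathcomp Require Import measurable_realfun.
Set Implicit Arguments.
Unset Strict Implicit.
Unset Printing Implicit Defensive.
Import Order.TTheory GRing.Theory Num.Theory.
Import numFieldNormedType.Exports.
Local Open Scope classical_set_scope.
Local Open Scope ring_scope.

(* R^n is 'rV[R]_n.  Its sigma-algebra is the one generated by the coordinate
   functions, i.e. the product (= Borel) sigma-algebra. *)
Definition rV_coord (R : realType) (n : nat) : 'I_n -> 'rV[R]_n -> R :=
  fun i x => x 0 i.

Section rV_measurable.
Variables (R : realType) (n : nat).

Let sigma := g_sigma_preimage (@rV_coord R n).

Let sigma0 : sigma set0.
Proof. exact: sigma_algebra0. Qed.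

Let sigmaC A : sigma A -> sigma (~` A).
Proof. exact: sigma_algebraC. Qed.

Let sigma_bigcup (F : _^nat) : (forall i, sigma (F i)) ->
  sigma (\bigcup_i (F i)).
Proof. exact: sigma_algebra_bigcup. Qed.

HB.instance Definition _ :=
  @isMeasurable.Build (measure_tuple_display default_measure_display)
    'rV[R]_n sigma sigma0 sigmaC sigma_bigcup.

End rV_measurable.

Lemma measurable_rV_coord (R : realType) (n : nat) (i : 'I_n) :
  measurable_fun [set: 'rV[R]_n] (rV_coord i).
Proof.
move=> _ Y mY; rewrite setTI; apply: sub_sigma_algebra => /=.
rewrite -bigcup_seq/=; exists i => /=; first by rewrite mem_index_enum.
by exists Y => //; rewrite setTI.
Qed.

Lemma measurable_fun_rVP d (T : measurableType d) (R : realType) (n : nat)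
    (f : T -> 'rV[R]_n) :
  (forall i, measurable_fun [set: T] (fun t => f t 0 i)) ->
  measurable_fun [set: T] f.
Proof.
move=> mf; suff H : g_sigma_preimage (fun i => @rV_coord R n i \o f)
    `<=` measurable.
  move=> _ A mA; apply: H.
  by rewrite (@g_sigma_preimage_comp _ _ n _ (@rV_coord R n) _ f); exists A.
apply: smallest_sub; first exact: sigma_algebra_measurable.
rewrite -bigcup_seq => A [i _] [B mB <-]; exact: mf.
Qed.

(* R * R^n ~ R^(n+1) *)
Definition rV_cons (R : realType) (n : nat) (p : R * 'rV[R]_n) : 'rV[R]_n.+1 :=
  \row_i if unlift ord0 i is Some j then p.2 0 j else p.1.

Definition rV_uncons (R : realType) (n : nat) (x : 'rV[R]_n.+1) :
    R * 'rV[R]_n :=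
  (x 0 ord0, \row_j x 0 (lift ord0 j)).

Lemma rV_consK (R : realType) (n : nat) :
  cancel (@rV_cons R n) (@rV_uncons R n).
Proof.
case=> a y; rewrite /rV_uncons /rV_cons !mxE unlift_none; congr pair.
by apply/rowP => j; rewrite !mxE liftK.
Qed.

Lemma rV_unconsK (R : realType) (n : nat) :
  cancel (@rV_uncons R n) (@rV_cons R n).
Proof.
move=> x; apply/rowP => i; rewrite !mxE.
by case: unliftP => [j ->|->] //=; rewrite mxE.
Qed.

Lemma measurable_rV_cons (R : realType) (n : nat) :
  measurable_fun [set: R * 'rV[R]_n] (@rV_cons R n).
Proof.
apply: measurable_fun_rVP => i; case: (unliftP ord0 i) => [j ->|->].
  under eq_fun do rewrite mxE liftK.
  apply: (measurableT_comp (measurable_rV_coord j)); exact: measurable_snd.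
under eq_fun do rewrite mxE unlift_none.
exact: measurable_fst.
Qed.

Lemma measurable_rV_uncons (R : realType) (n : nat) :
  measurable_fun [set: 'rV[R]_n.+1] (@rV_uncons R n).
Proof.
apply/measurable_fun_pairP; split; first exact: measurable_rV_coord.
apply: measurable_fun_rVP => i.
under eq_fun do rewrite /= mxE.
exact: measurable_rV_coord.
Qed.

(* One step of the construction of Lebesgue measure on R^n: the image of
   dx \x m under R * R^n ~ R^(n+1). *)
Definition lebesgue_rV_step (R : realType) (n : nat)
    (m : {sigma_finite_measure set 'rV[R]_n -> \bar R}) :
    set 'rV[R]_n.+1 -> \bar R :=
  pushforward (lebesgue_measure \x m)%E (@rV_cons R n).

Section lebesgue_rV_step.
Variables (R : realType) (n : nat).
Variable m : {sigma_finite_measure set 'rV[R]_n -> \bar R}.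

Let mcons : measurable_fun [set: R * 'rV[R]_n] (@rV_cons R n) :=
  @measurable_rV_cons R n.

Let step0 : lebesgue_rV_step m set0 = 0%E.
Proof. by rewrite /lebesgue_rV_step /pushforward preimage_set0 measure0. Qed.

Let step_ge0 A : (0 <= lebesgue_rV_step m A)%E.
Proof. exact: measure_ge0. Qed.

Let step_sigma_additive : semi_sigma_additive (lebesgue_rV_step m).
Proof. exact: (@measure_semi_sigma_additive _ _ _ (pushforward _ _)). Qed.

HB.instance Definition _ := isMeasure.Build _ _ _ (lebesgue_rV_step m)
  step0 step_ge0 step_sigma_additive.

Let step_sigma_finite : sigma_finite setT (lebesgue_rV_step m).
Proof.
have /sigma_finiteP[F [TF ndF Foo]] := sigma_finiteT (@lebesgue_measure R).
have /sigma_finiteP[G [TG ndG Goo]] := sigma_finiteT m.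
exists (fun k => @rV_uncons R n @^-1` (F k `*` G k)).
  rewrite -preimage_bigcup (_ : \bigcup_k (F k `*` G k) = setT) ?preimage_setT//.
  rewrite predeqE => -[x y]; split => // _.
  have [k _ Fkx] : (\bigcup_k F k) x by rewrite -TF.
  have [l _ Gly] : (\bigcup_k G k) y by rewrite -TG.
  exists (maxn k l) => //; split => /=.
    by move: x Fkx; exact/subsetPset/ndF/leq_maxl.
  by move: y Gly; exact/subsetPset/ndG/leq_maxr.
move=> k; have [mF Fk] := Foo k; have [mG Gk] := Goo k; split.
  rewrite -[X in measurable X]setTI; apply: measurable_rV_uncons => //.
  exact: measurableX.
rewrite /lebesgue_rV_step /pushforward -comp_preimage.
rewrite (_ : _ \o _ = id); last by apply/funext => p /=; exact: rV_consK.
by rewrite preimage_id product_measure1E// lte_mul_pinfty// ge0_fin_numE.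
Qed.

HB.instance Definition _ := Measure_isSigmaFinite.Build _ _ _
  (lebesgue_rV_step m) step_sigma_finite.

End lebesgue_rV_step.

(* n-dimensional Lebesgue measure; R^0 is a point of mass 1 *)
Fixpoint lebesgue_rV (R : realType) (n : nat) :
    {sigma_finite_measure set 'rV[R]_n -> \bar R} :=
  match n return {sigma_finite_measure set 'rV[R]_n -> \bar R} with
  | 0 => dirac (0 : 'rV[R]_0)
  | k.+1 => lebesgue_rV_step (lebesgue_rV R k)
  end.

Section drift_heat_semigroup.
Variables (R : realType) (n : nat).
Local Notation E := 'rV[R]_n.

(* f(y) = |y|^2 / 4 for the Euclidean norm; the library norm on 'rV[R]_n is
   the sup norm, hence the explicit sum of squares. *)
Definition potential (y : E) : R := (\sum_(i < n) y 0 i ^+ 2) / 4.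

Lemma measurable_potential : measurable_fun [set: E] potential.
Proof.
apply: measurable_funM => //; apply: measurable_sum => i.
by apply: measurable_funX; exact: measurable_rV_coord.
Qed.

(* the measure e^{- f / s} dy *)
Definition weighted_measure (s : R) (A : set E) : \bar R :=
  (\int[lebesgue_rV R n]_(y in A) (expR (- (potential y / s)))%:E)%E.

Section weighted_measure.
Variable s : R.

Let wm0 : weighted_measure s set0 = 0%E.
Proof. exact: integral_set0. Qed.

Let wm_ge0 A : (0 <= weighted_measure s A)%E.
Proof. by apply: integral_ge0 => y _; rewrite lee_fin expR_ge0. Qed.

Let wm_sigma_additive : semi_sigma_additive (weighted_measure s).
Proof.
apply: semi_sigma_additive_nng_induced => [|y]; last by rewrite lee_fin expR_ge0.
apply/measurable_EFinP/measurableT_comp => //; apply: measurableT_comp => //.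
by apply: measurable_funM => //; exact: measurable_potential.
Qed.

HB.instance Definition _ := isMeasure.Build _ _ _ (weighted_measure s)
  wm0 wm_ge0 wm_sigma_additive.

End weighted_measure.

Definition L2norm (s : R) (u : E -> R) : \bar R :=
  'N[weighted_measure s]_2%:E[EFin \o u].

(* Elements of L^2(R^n, e^{-f} dy) are handled through representatives:
   equality in L^2 is vanishing of the norm of the difference. *)
Definition L2 := LfunType (weighted_measure 1) (@lee1n R 2).

Definition partial (i : 'I_n) (u : E -> R) : E -> R := 'D_(delta_mx 0 i) u.

Fixpoint Ck (k : nat) (u : E -> R) : Prop :=
  match k with
  | 0 => continuous u
  | l.+1 => continuous u /\
      forall i, (forall y, derivable u y (delta_mx 0 i)) /\ Ck l (partial i u)
  end.

(* C_c^oo(R^n) *)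
Definition test_function (phi : E -> R) : Prop :=
  (forall k, Ck k phi) /\ compact (closure [set y | phi y != 0]).

Definition drift_laplacian (u : E -> R) (y : E) : R :=
  \sum_(i < n) partial i (partial i u) y
  - 2^-1 * \sum_(i < n) y 0 i * partial i u y.

(* u belongs to the domain of Delta_f on L^2(e^{-f} dy), with Delta_f u = w:
   Delta_f u, taken in the sense of distributions on the weighted manifold
   (R^n, e^{-f} dy), is w.  There is no ambiguity in the choice of the domain:
   Delta_f is essentially self-adjoint on C_c^oo(R^n), so this operator is also
   the closure of its restriction to C_c^oo(R^n). *)
Definition drift_laplacian_L2 (u w : L2) : Prop :=
  forall phi, test_function phi ->
    (\int[weighted_measure 1]_y (u y * drift_laplacian phi y)%:E =
     \int[weighted_measure 1]_y (w y * phi y)%:E)%E.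

(* (P_h u - u) / h --> w in L^2 as h --> 0+ *)
Definition infinitesimal_generator (P : R -> L2 -> L2) (u w : L2) : Prop :=
  L2norm 1 (h^-1 *: (P h u - u) - w) @[h --> 0^'+] --> 0%E.

(* Strongly continuous semigroup of bounded operators; P is only constrained
   at nonnegative times. *)
Record is_C0_semigroup (P : R -> L2 -> L2) : Prop := {
  C0_linear : forall t, 0 <= t -> forall (a : R) (u v : L2),
    L2norm 1 (P t (a *: u + v) - (a *: P t u + P t v)) = 0%E;
  C0_bounded : forall t, 0 <= t -> exists C : R, forall u : L2,
    (L2norm 1 (P t u) <= C%:E * L2norm 1 u)%E;
  C0_id : forall u : L2, L2norm 1 (P 0 u - u) = 0%E;
  C0_add : forall s t, 0 <= s -> 0 <= t -> forall u : L2,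
    L2norm 1 (P (s + t) u - P s (P t u)) = 0%E;
  C0_continuous : forall u : L2,
    L2norm 1 (P h u - u) @[h --> 0^'+] --> 0%E }.

(* P_t = e^{t Delta_f}.  A strongly continuous semigroup is determined by its
   generator, so P is unique up to null sets. *)
Definition drift_heat_semigroup (P : R -> L2 -> L2) : Prop :=
  is_C0_semigroup P /\
  forall u w : L2,
    infinitesimal_generator P u w <-> drift_laplacian_L2 u w.

End drift_heat_semigroup.

Arguments L2 : clear implicits.

(* Main.v *)
Require Import Defs.
From HB Require Import structures.
From mathcomp Require Import all_boot all_order all_algebra.
From mathcomp Require Import all_classical all_reals all_analysis.
From mathcomp Require Import measurable_realfun ring lra.
Import Order.TTheory GRing.Theory Num.Theory.
Import numFieldNormedType.Exports.
Local Open Scope classical_set_scope.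
Local Open Scope ring_scope.

(** The Mehler formula P_t v (y) = E v(e^{-t/2} y + sqrt(2(1 - e^{-t})) Z), with
    Z a standard Gaussian vector, shows that after the substitution
    y = e^{t/2} z the rescaled norms converge to the norm of the heat flow
    e^Delta v in L2(e^{-|z|^2/2} dz).  What has to be found are functions v for
    which this limit almost equals the norm of v in L2(e^{-|z|^2/4} dz).
    The constant 1 only gives the ratio 2^{-n/4}; the Gaussians v = e^{b |y|^2} with
    b close to the critical value 1/8, from which on v is no longer in
    L2(e^{-f} dy), are almost extremal.

    A Gaussian stays Gaussian under the flow.  Writing u_t = e^{c(t) + b(t)|y|^2},
    the equation du/dt = Delta_f u reduces to the Riccati system
    b' = 4 b^2 - b, c' = 2 n b, solved explicitly by b(t) = b e^{-t} / q(t) and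
    c(t) = - (n/2) ln q(t), with b = b(0) and q(t) = 1 - 4 b + 4 b e^{-t}.  The norms of u_t are Gaussian integrals, and
    the limit is e^{-n/4 ln(2(1 - 4b))} times the norm of v: the square of the
    ratio is (2(1 - 4b))^{-n/2}, which tends to 1 as b tends to 1/8
    (lemmas scaled_L2norm_gaussian, limit_ratio).

    It remains to know that P_t v is u_t, where P is only given as a strongly
    continuous semigroup whose generator is the distributional drift Laplacian.
    An integration by parts (drift_laplacian_gaussian) puts every u_s in the domain
    of the generator, with the value du_s/ds.  Hence s |-> P_{t-s} u_s has right
    derivative zero on [0, t], and is constant (semigroup_uniqueness).  That last
    step needs the operators P_h to be bounded uniformly for h in [0, t]; this is
    the uniform boundedness principle, proved here by a gliding hump in the
    complete seminormed space of square-integrable functions (gliding_hump,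
    L2_rapidly_complete).  Everything is done with representatives: operators
    are linear, and the semigroup law holds, up to elements of seminorm zero. *)

Set Implicit Arguments.
Unset Strict Implicit.
Unset Printing Implicit Defensive.

(** * Seminormed spaces and the gliding hump *)

Section seminorm.
Variables (R : realType) (V : lmodType R).

Record is_seminorm (N : V -> R) : Prop := IsSeminorm {
  seminormD : forall u v, N (u + v) <= N u + N v ;
  seminormZ : forall a u, N (a *: u) = `|a| * N u }.

(** Completeness, for Cauchy sequences of geometric rate only; the constant 4 / 3
    is the sum of the remaining steps.  The gliding hump needs the ratio 4^-1, for
    which the tail after step k, (4/3) 4^-(k+1), is less than half of that step. *)
Definition rapidly_complete (N : V -> R) : Prop :=
  forall x : nat -> V, (forall k, N (x k.+1 - x k) <= 4^-1 ^+ k) ->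
    exists y, forall k, N (y - x k) <= 4 / 3 * 4^-1 ^+ k.

Definition linear_mod (N : V -> R) (T : V -> V) : Prop :=
  forall a u v, N (T (a *: u + v) - (a *: T u + T v)) = 0.

Definition bounded_by (N : V -> R) (T : V -> V) (C : R) : Prop :=
  forall u, N (T u) <= C * N u.

Variables (N : V -> R) (Ns : is_seminorm N).

Lemma seminorm0 : N 0 = 0.
Proof. by rewrite -(scale0r 0) (seminormZ Ns) normr0 mul0r. Qed.

Lemma seminormN u : N (- u) = N u.
Proof. by rewrite -scaleN1r (seminormZ Ns) normrN1 mul1r. Qed.

Lemma seminorm_ge0 u : 0 <= N u.
Proof.
by have := seminormD Ns u (- u); rewrite subrr seminorm0 seminormN; lra.
Qed.

Lemma seminormB u v : N (u - v) <= N u + N v.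
Proof. by rewrite -(seminormN v) (seminormD Ns). Qed.

Lemma seminorm_distC u v : N (u - v) = N (v - u).
Proof. by rewrite -seminormN opprB. Qed.

Lemma seminorm_trans v u w : N (u - w) <= N (u - v) + N (v - w).
Proof. by rewrite (le_trans _ (seminormD Ns _ _))// addrA subrK. Qed.

Lemma seminorm_sub0 u v : N (u - v) = 0 -> N u = N v.
Proof.
move=> uv0; apply/eqP; rewrite eq_le.
have := seminorm_trans v u 0; have := seminorm_trans u v 0.
by rewrite !subr0 (seminorm_distC v u) uv0 !add0r => -> ->.
Qed.

Section linear_mod.
Variables (T : V -> V) (Tl : linear_mod N T).

Lemma linear_modB u v : N (T (u - v) - (T u - T v)) = 0.
Proof.
by have := Tl (-1) v u; rewrite !scaleN1r (addrC (- v)) (addrC (- T v)).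
Qed.

Lemma linear_modZ a u : N (T (a *: u)) = `|a| * N (T u).
Proof.
have T0 : N (T 0) = 0.
  have := linear_modB 0 0; rewrite !subrr subr0//.
have := Tl a u 0; rewrite addr0 opprD addrA => h.
rewrite -(seminormZ Ns); apply: seminorm_sub0.
apply/eqP; rewrite eq_le seminorm_ge0 andbT.
have -> : T (a *: u) - a *: T u = (T (a *: u) - a *: T u - T 0) + T 0.
  by rewrite subrK.
by rewrite (le_trans (seminormD Ns _ _))// h T0 addr0.
Qed.

Lemma linear_mod_distl C u v : bounded_by N T C ->
  N (T u - T v) <= C * N (u - v).
Proof.
move=> TC; apply: le_trans (TC _).
by rewrite -(seminorm_sub0 (linear_modB u v)).
Qed.

(** 2 T y = T (x + y) - T (x - y), so one of the two values is at least as large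
    as T y: whatever x is, a perturbation by y or by - y makes T large. *)
Lemma linear_mod_hump x y : N (T y) <= N (T (x + y)) \/ N (T y) <= N (T (x - y)).
Proof.
have h : N (2 *: T y) <= N (T (x + y)) + N (T (x - y)).
  rewrite (le_trans _ (seminormB _ _))//.
  rewrite (seminormZ Ns) -linear_modZ.
  have := linear_modB (x + y) (x - y) => /seminorm_sub0 <-.
  by rewrite opprB addrC addrA subrK scaler_nat mulr2n.
move: h; rewrite (seminormZ Ns) normr_nat => h.
by have [|] := leP (N (T y)) (N (T (x + y))); [left|right; lra].
Qed.

(** Here c is the operator norm of T, that is the least bound; half of it is no
    longer a bound, so it is exceeded on some vector, which is then normalized. *)
Lemma almost_norming B C : 0 < B -> bounded_by N T C -> ~ bounded_by N T B ->
  exists c u, [/\ B <= c, bounded_by N T c, N u = 1 & c / 2 <= N (T u)].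
Proof.
move=> B0 TC TB.
have lbB c : bounded_by N T c -> B <= c.
  move=> Tc; rewrite leNgt; apply/negP => cB; apply: TB => u.
  by rewrite (le_trans (Tc u))// ler_wpM2r ?seminorm_ge0// ltW.
pose A := [set c | bounded_by N T c].
have A0 : has_inf A by split; [exists C|exists B => c /lbB].
have Bi : B <= inf A by apply: lb_le_inf; [exists C|move=> c /lbB].
have i0 : 0 < inf A by rewrite (lt_le_trans B0).
have Ti : bounded_by N T (inf A).
  move=> u; apply/ler_addgt0Pr => e e0.
  have d0 : 0 < e / (N u + 1) by rewrite divr_gt0// ltr_wpDl// seminorm_ge0.
  have [c Ac ci] := inf_adherent d0 A0.
  rewrite (le_trans (Ac u))// (@le_trans _ _ ((inf A + e / (N u + 1)) * N u))//.
    by rewrite ler_wpM2r ?seminorm_ge0// ltW.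
  rewrite mulrDl lerD2l -mulrA ler_piMr ?(ltW e0)// mulrC ler_pdivrMr ?mul1r.
    by rewrite lerDl.
  by rewrite ltr_wpDl// seminorm_ge0.
have : ~ bounded_by N T (inf A / 2).
  by move=> /(ge_inf A0.2); rewrite -subr_ge0; lra.
move=> /existsNP[u /negP]; rewrite -ltNge => uT.
have Nu : 0 < N u.
  rewrite lt_neqAle seminorm_ge0 andbT; apply/eqP => Nu0.
  by have := Ti u; move: uT; rewrite -Nu0 !mulr0 => /lt_le_trans /[apply]; rewrite ltxx.
exists (inf A), ((N u)^-1 *: u); split => //.
  by rewrite (seminormZ Ns) gtr0_norm ?invr_gt0// mulVf// gt_eqF.
by rewrite linear_modZ gtr0_norm ?invr_gt0// [leRHS]mulrC ler_pdivlMr// ltW.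
Qed.

End linear_mod.

(** Sokal's proof of the uniform boundedness principle.  Starting from 0, the k-th
    step adds + or - 4^-k u_k, where u_k almost norms T_k and the sign is the one
    of linear_mod_hump; T_k is then at least 4^-k |T_k| / 2 at the current point.
    The later steps change T_k by at most 4^-k |T_k| / 3, which leaves
    4^-k |T_k| / 6 >= 2^k / 6 at the limit point. *)
Lemma gliding_hump (T : nat -> V -> V) : rapidly_complete N ->
  (forall k, linear_mod N (T k)) ->
  (forall k, exists C, bounded_by N (T k) C) ->
  (forall k, ~ bounded_by N (T k) (8 ^+ k)) ->
  exists x, forall k, 2 ^+ k / 6 <= N (T k x).
Proof.
move=> Nc Tl Tb Tu.
have /choice[c /choice[u cu]] k : exists c u,
    [/\ 8 ^+ k <= c, bounded_by N (T k) c, N u = 1 & c / 2 <= N (T k u)].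
  by have [C TC] := Tb k; apply: (almost_norming (Tl k) _ TC) => //; exact: exprn_gt0.
pose step k x := let y := 4^-1 ^+ k *: u k in
  if N (T k y) <= N (T k (x + y)) then x + y else x - y.
pose x := fix x k := if k is j.+1 then step j (x j) else 0.
have Nu k : N (4^-1 ^+ k *: u k) = 4^-1 ^+ k.
  have [_ _ u1 _] := cu k.
  by rewrite (seminormZ Ns) u1 mulr1 ger0_norm.
have [k|y yx] := Nc x.
  rewrite /= /step; case: ifP => _; rewrite addrAC subrr add0r ?seminormN Nu//.
exists y => k; have [ck Tc u1 cT] := cu k.
have hump : 4^-1 ^+ k * (c k / 2) <= N (T k (x k.+1)).
  apply: (@le_trans _ _ (N (T k (4^-1 ^+ k *: u k)))).
    by rewrite (linear_modZ (Tl k)) ger0_norm// ler_wpM2l.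
  rewrite /= /step; case: ifPn => // /negP h.
  by case: (linear_mod_hump (Tl k) (x k) (4^-1 ^+ k *: u k)).
have tail : N (T k (x k.+1)) - N (T k y) <= c k * (4 / 3 * 4^-1 ^+ k.+1).
  apply: (@le_trans _ _ (N (T k (x k.+1) - T k y))).
    by have := seminorm_trans (T k y) (T k (x k.+1)) 0; rewrite !subr0; lra.
  apply: le_trans (linear_mod_distl (Tl k) _ _ Tc) _.
  rewrite ler_wpM2l// ?(le_trans _ ck)// ?exprn_ge0// seminorm_distC.
  exact: yx.
have h2 : 2 ^+ k <= 4^-1 ^+ k * c k.
  have -> : 2 ^+ k = 4^-1 ^+ k * 8 ^+ k :> R.
    by rewrite -exprMn; congr (_ ^+ _); field.
  by rewrite ler_wpM2l.
rewrite exprS in tail; set a := 4^-1 ^+ k in hump tail h2 *.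
have : a * (c k / 2) - c k * (4 / 3 * (4^-1 * a)) = a * c k / 6 by field.
lra.
Qed.

End seminorm.

(** * Strongly continuous semigroups modulo a seminorm *)

Section near0.
Variable R : realType.

Lemma near0_rightP (Q : R -> Prop) :
  (\forall h \near 0^'+, Q h) <-> exists2 d, 0 < d & forall h, 0 < h < d -> Q h.
Proof.
split.
  move=> /nbhs_ballP[d /= d0 dQ]; exists d => // h /andP[h0 hd]; apply: dQ => //=.
  by rewrite /ball/= sub0r normrN gtr0_norm.
move=> [d d0 dQ]; near=> h; exact/dQ/andP.
Unshelve. all: by end_near. Qed.

Lemma cvg0_rightP (F : R -> R) : F h @[h --> 0^'+] --> 0 ->
  forall e, 0 < e -> \forall h \near 0^'+, F h < e.
Proof.
move=> /cvgr0Pnorm_lt F0 e e0; near=> h.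
by rewrite (le_lt_trans (ler_norm _))//; near: h; exact: F0.
Unshelve. all: by end_near. Qed.

Lemma cvg0_right_linear (F : R -> R) (d C : R) : 0 < d ->
  (forall h, 0 < h < d -> 0 <= F h <= h * C) -> F h @[h --> 0^'+] --> 0.
Proof.
move=> d0 FC; apply/cvgr0Pnorm_lt => e e0.
have C1 : 0 < `|C| + 1 by rewrite ltr_wpDl.
apply/near0_rightP; exists (Num.min d (e / (`|C| + 1))).
  by rewrite lt_min d0 divr_gt0.
move=> h /andP[h0]; rewrite lt_min => /andP[hd he].
have /andP[F0 Fh] : 0 <= F h <= h * C by rewrite FC// h0.
rewrite ger0_norm//; apply: (le_lt_trans Fh); rewrite ltr_pdivlMr// in he.
apply: le_lt_trans he; rewrite ler_pM2l//.
by rewrite (le_trans (ler_norm _))// lerDl.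
Qed.

(** A function whose upper right derivative is nonpositive, and which does not jump
    upwards at a point approached from the left, does not increase.  For every
    slope e > 0, the set of the s with F r <= e r on all of [0, s] is closed by the second
    hypothesis and cannot stop before t by the first one. *)
Lemma le0_right_growth (F : R -> R) (t : R) : 0 <= t -> F 0 <= 0 ->
  (forall s, 0 <= s < t -> forall e, 0 < e ->
    \forall h \near 0^'+, F (s + h) <= F s + e * h) ->
  (forall s, 0 < s <= t -> forall e, 0 < e ->
    \forall h \near 0^'+, F s <= F (s - h) + e) ->
  F t <= 0.
Proof.
move=> t0 F0 Fr Fl.
suff H e : 0 < e -> F t <= e * t.
  apply/ler_addgt0Pr => e e0; rewrite add0r.
  have t1 : 0 < t + 1 by lra.
  rewrite (le_trans (H (e / (t + 1)) _)) ?divr_gt0//.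
  by rewrite mulrAC ler_pdivrMr// ler_pM2l//; lra.
move=> e0.
pose S := [set s | 0 <= s <= t /\ forall r, 0 <= r <= s -> F r <= e * r].
have S0 : S 0.
  split=> [|r]; first by rewrite lexx.
  by move=> /le_anti <-; rewrite mulr0.
have Sub : has_sup S by split; [exists 0|exists t => s [/andP[]]].
set T := sup S.
have T0 : 0 <= T by exact: ub_le_sup Sub.2 _ S0.
have Tt : T <= t by apply: ge_sup; [exists 0|move=> s [/andP[]]].
have ltT r : 0 <= r -> r < T -> F r <= e * r.
  move=> r0 rT; have d0 : 0 < T - r by rewrite subr_gt0.
  have [s [_ Ss] sT] := sup_adherent d0 Sub.
  by apply: Ss; rewrite -/T in sT; apply/andP; split => //; lra.
have FT : F T <= e * T.
  have [->|Tn0] := eqVneq T 0; first by rewrite mulr0.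
  have Tp : 0 < T by rewrite lt_neqAle eq_sym Tn0.
  apply/ler_addgt0Pr => e' e'0.
  have [|d d0 Hd] := (iffLR (near0_rightP _)) (Fl T _ e' e'0); first by rewrite Tp.
  pose h := Num.min (d / 2) (T / 2).
  have h0 : 0 < h by rewrite lt_min; apply/andP; split; lra.
  have hd : h <= d / 2 by rewrite ge_min lexx.
  have hT : h <= T / 2 by rewrite ge_min lexx orbT.
  have := Hd h; have -> : 0 < h < d by rewrite h0; lra.
  move=> /(_ isT) /le_trans; apply; rewrite lerD2r.
  rewrite (le_trans (ltT _ _ _))//; try lra.
  by rewrite ler_pM2l//; lra.
have [<-//|Tnt] := eqVneq T t.
have Tlt : T < t by rewrite lt_neqAle Tnt.
have [|d d0 Hd] := (iffLR (near0_rightP _)) (Fr T _ e e0); first by rewrite T0.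
pose h := Num.min (d / 2) (t - T).
have h0 : 0 < h by rewrite lt_min; apply/andP; split; lra.
have hd : h <= d / 2 by rewrite ge_min lexx.
have hT : h <= t - T by rewrite ge_min lexx orbT.
suff : S (T + h) by move=> /(ub_le_sup Sub.2); rewrite -/T; lra.
split; first lra.
move=> r /andP[r0 rTh]; have [rT|Tr] := ltP r T; first exact: ltT.
have [->//|rnT] := eqVneq r T.
have Tltr : T < r by rewrite lt_neqAle eq_sym rnT.
have := Hd (r - T); have -> : 0 < r - T < d by apply/andP; split; lra.
move=> /(_ isT); rewrite addrC subrK => /le_trans; apply; lra.
Qed.

End near0.

Section semigroup.
Variables (R : realType) (V : lmodType R) (N : V -> R) (P : R -> V -> V).

Record is_semigroup_mod : Prop := IsSemigroupMod {
  semigroup_linear : forall t, 0 <= t -> linear_mod N (P t) ;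
  semigroup_bounded : forall t, 0 <= t -> exists C, bounded_by N (P t) C ;
  semigroup_id : forall u, N (P 0 u - u) = 0 ;
  semigroup_add : forall s t, 0 <= s -> 0 <= t -> forall u,
    N (P (s + t) u - P s (P t u)) = 0 ;
  semigroup_continuous : forall u, N (P h u - u) @[h --> 0^'+] --> 0 }.

Hypotheses (Ns : is_seminorm N) (Nc : rapidly_complete N).
Hypothesis (HP : is_semigroup_mod).

(** Otherwise there would be times h_k <= 1 / (k + 1) at which 8^k is not a bound
    of P_{h_k}, and the gliding hump would give an x for which P_{h_k} x is
    unbounded, although it tends to x. *)
Lemma semigroup_bounded_near0 : exists d M, [/\ 0 < d, 1 <= M &
  forall h, 0 <= h <= d -> bounded_by N (P h) M].
Proof.
apply: contrapT => nb.
have /choice[h hP] k : exists h, 0 <= h <= k.+1%:R^-1 /\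
    ~ bounded_by N (P h) (8 ^+ k).
  apply: contrapT => nh; apply: nb; exists k.+1%:R^-1, (8 ^+ k); split => //.
    by rewrite exprn_ege1// ler1n.
  by move=> h hk; apply: contrapT => hN; apply: nh; exists h.
have h0 k : 0 <= h k by case: (hP k) => /andP[].
have [x xP] := @gliding_hump _ _ _ Ns (fun k => P (h k)) Nc
  (fun k => semigroup_linear HP (h0 k)) (fun k => semigroup_bounded HP (h0 k))
  (fun k => (hP k).2).
have Pb k : N (P (h k) x) <= N (P (h k) x - x) + N x.
  by have := seminorm_trans Ns x (P (h k) x) 0; rewrite !subr0.
have /near0_rightP[d d0 Hd] := cvg0_rightP (semigroup_continuous HP x) ltr01.
(* The orbit of x stays bounded on the times h_k < d; the case h_k = 0, which the
   one-sided limit does not cover, is the identity axiom. *)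
have small k : k.+1%:R^-1 < d -> N (P (h k) x) <= 1 + N x.
  move=> kd; apply: (le_trans (Pb k)); rewrite lerD2r.
  have [hk0|hk0] := eqVneq (h k) 0.
    by rewrite hk0 (semigroup_id HP).
  apply/ltW/Hd; rewrite lt_neqAle eq_sym hk0 h0/= (le_lt_trans _ kd)//.
  by case: (hP k) => /andP[].
pose k := maxn (Num.truncn d^-1) (Num.truncn (6 * (1 + N x))).
have kd : k.+1%:R^-1 < d.
  rewrite invf_plt ?posrE//; apply: lt_le_trans (truncnS_gt _) _.
  by rewrite ler_nat ltnS leq_maxl.
have := le_trans (xP k) (small k kd).
rewrite ler_pdivrMr// leNgt => /negP; apply.
apply: (@lt_le_trans _ _ k.+1%:R).
  rewrite mulrC; apply: lt_le_trans (truncnS_gt _) _.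
  by rewrite ler_nat ltnS leq_maxr.
by rewrite -natrX ler_nat ltn_expl.
Qed.

(** If M bounds P_h for h <= d then M^(k+1) bounds it for h <= k d, because
    P_h = P_d P_{h - d}. *)
Lemma semigroup_locally_bounded t : exists M, 1 <= M /\
  forall h, 0 <= h <= t -> bounded_by N (P h) M.
Proof.
have [d [M [d0 M1 dM]]] := semigroup_bounded_near0.
have H k : forall h, 0 <= h <= k%:R * d -> bounded_by N (P h) (M ^+ k.+1).
  elim: k => [|k IH] h.
    by rewrite mul0r => h0 u; rewrite expr1; apply: dM; lra.
  rewrite -natr1 mulrDl mul1r => /andP[h0 hk] u.
  have M0 : 0 <= M by lra.
  have MX j : 1 <= M ^+ j by exact: exprn_ege1.
  have [hd|dh] := leP h d.
    apply: (le_trans (dM _ _ u)); first by rewrite h0.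
    by rewrite exprS ler_wpM2r ?seminorm_ge0// ler_peMr.
  have hd0 : 0 <= h - d by lra.
  have := semigroup_add HP (ltW d0) hd0 u; rewrite (addrC d) subrK => /(seminorm_sub0 Ns) ->.
  apply: (le_trans (dM d _ _)); first by rewrite lexx andbT ltW.
  rewrite [in leRHS]exprS -mulrA ler_wpM2l//; apply: IH; lra.
pose k := (Num.truncn (t / d)).+1.
have kt : t <= k%:R * d by rewrite -ler_pdivrMr// ltW// truncnS_gt.
exists (M ^+ k.+1); split; first exact: exprn_ege1.
by move=> h /andP[h0 ht]; apply: H; rewrite h0 (le_trans ht).
Qed.

(** A curve g with g' = A g, A being the generator, is an orbit.  Along
    F s = N (P_{t-s} g_s - P_t g_0) one has
    P_{t-s-h} g_{s+h} - P_{t-s} g_s = P_{t-s-h} (g_{s+h} - P_h g_s), where the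
    bracket is o(h) since both differences g_{s+h} - g_s and P_h g_s - g_s are
    h w_s + o(h); the operators in front are bounded uniformly in h. *)
Theorem semigroup_uniqueness (g w : R -> V) :
  (forall s, 0 <= s ->
    N (h^-1 *: (P h (g s) - g s) - w s) @[h --> 0^'+] --> 0) ->
  (forall s, 0 <= s ->
    N (h^-1 *: (g (s + h) - g s) - w s) @[h --> 0^'+] --> 0) ->
  (forall s, 0 < s -> N (g s - g (s - h)) @[h --> 0^'+] --> 0) ->
  forall t, 0 <= t -> N (P t (g 0) - g t) = 0.
Proof.
move=> gP gD gL t t0.
have [M [M1 tM]] := semigroup_locally_bounded t.
have M0 : 0 < M by lra.
have err s e : 0 <= s -> 0 < e ->
    \forall h \near 0^'+, N (g (s + h) - P h (g s)) <= e * h.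
  move=> s0 e0; have e20 : 0 < e / 2 by lra.
  have /near0_rightP[d1 d10 H1] := cvg0_rightP (gP s s0) e20.
  have /near0_rightP[d2 d20 H2] := cvg0_rightP (gD s s0) e20.
  apply/near0_rightP; exists (Num.min d1 d2) => [|h]; first by rewrite lt_min d10.
  rewrite lt_min => /and3P[h0 hd1 hd2].
  have := H1 h; have := H2 h; rewrite h0 hd1 hd2 => /(_ isT) k2 /(_ isT) k1.
  rewrite mulrC -ler_pdivrMl//.
  have <- : N (h^-1 *: (g (s + h) - P h (g s))) = h^-1 * N (g (s + h) - P h (g s)).
    by rewrite (seminormZ Ns) gtr0_norm// invr_gt0.
  have -> : h^-1 *: (g (s + h) - P h (g s)) =
      (h^-1 *: (g (s + h) - g s) - w s) - (h^-1 *: (P h (g s) - g s) - w s).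
    by rewrite opprB addrA subrK -scalerBr opprB addrA subrK.
  by apply: (le_trans (seminormB Ns _ _)); lra.
pose F s := N (P (t - s) (g s) - P t (g 0)).
suff : F t <= 0.
  rewrite /F subrr => F0; apply/eqP; rewrite eq_le seminorm_ge0// andbT.
  apply: le_trans F0.
  have := seminorm_trans Ns (P 0 (g t)) (P t (g 0)) (g t).
  by rewrite (semigroup_id HP) addr0 (seminorm_distC Ns (P 0 (g t))).
have step r s : 0 <= r -> 0 < s -> s <= t -> r < s ->
    F s <= F r + M * N (g s - P (s - r) (g r)) /\ 
    N (P (t - r) (g r) - P (t - s) (P (s - r) (g r))) = 0.
  move=> r0 s0 st rs.
  have ts0 : 0 <= t - s by lra.
  have sr0 : 0 <= s - r by lra.
  have := semigroup_add HP ts0 sr0 (g r); rewrite addrA subrK => add0.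
  split => //; apply: le_trans (seminorm_trans Ns (P (t - r) (g r)) _ _) _.
  rewrite addrC lerD2l.
  apply: le_trans (seminorm_trans Ns (P (t - s) (P (s - r) (g r))) _ _) _.
  rewrite (seminorm_distC Ns _ (P (t - r) (g r))) add0 addr0.
  apply: (linear_mod_distl Ns (semigroup_linear HP ts0)).
  by apply: tM; lra.
apply: le0_right_growth => //.
- by rewrite /F subr0 subrr seminorm0.
- move=> s /andP[s0 st] e e0.
  have /near0_rightP[d d0 Hd] := err s (e / M) s0 (divr_gt0 e0 M0).
  apply/near0_rightP; exists (Num.min d (t - s)) => [|h].
    by rewrite lt_min d0; lra.
  rewrite lt_min => /and3P[h0 hd hts].
  have [|||| H _] := step s (s + h); try lra.
  apply: (le_trans H); rewrite lerD2l.
  have -> : s + h - s = h by lra.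
  rewrite -ler_pdivlMl// mulrA (mulrC _ e).
  by apply: Hd; rewrite h0.
- move=> s /andP[s0 st] e e0.
  have MM : 0 < M + M * M by rewrite addr_gt0// mulr_gt0.
  have e1 := divr_gt0 e0 MM.
  have /near0_rightP[d1 d10 H1] := cvg0_rightP (semigroup_continuous HP (g s)) e1.
  have /near0_rightP[d2 d20 H2] := cvg0_rightP (gL s s0) e1.
  apply/near0_rightP; exists (Num.min (Num.min d1 d2) s) => [|h].
    by rewrite !lt_min d10 d20.
  rewrite !lt_min => /and3P[h0 /andP[hd1 hd2] hs].
  have := H1 h; have := H2 h; rewrite h0 hd1 hd2 => /(_ isT) k2 /(_ isT) k1.
  have [|||| H _] := step (s - h) s; try lra.
  apply: (le_trans H); rewrite lerD2l (_ : s - (s - h) = h); last by lra.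
  have eE : e = M * (e / (M + M * M) + M * (e / (M + M * M))).
    by field; rewrite gt_eqF.
  rewrite [leRHS]eE ler_pM2l//.
  apply: le_trans (seminorm_trans Ns (P h (g s)) _ _) _.
  apply: lerD; first by rewrite (seminorm_distC Ns) ltW.
  have h1 : 0 <= h by lra.
  apply: (le_trans (linear_mod_distl Ns (semigroup_linear HP h1) _ _ (tM h _))).
    by lra.
  by rewrite ler_pM2l// ltW.
Qed.

End semigroup.

(** * Square-integrable functions: seminorm and completeness *)

Section L2_complete.
Variables (d : measure_display) (T : measurableType d) (R : realType).
Variable mu : {measure set T -> \bar R}.
Local Notation L := (LfunType mu (@lee1n R 2)).
Local Notation nm f := ('N[mu]_2%:E[EFin \o f])%E.

Lemma Lnorm2_sqr (f : T -> R) : (nm f `^ 2 = \int[mu]_x (f x ^+ 2)%:E)%E.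
Proof.
rewrite poweR_Lnorm//; apply: eq_integral => x _ /=.
by rewrite powR_mulrn// real_normK// num_real.
Qed.

Lemma Lnorm2E (f : T -> R) : (nm f = (\int[mu]_x (f x ^+ 2)%:E) `^ 2^-1)%E.
Proof. by rewrite -Lnorm2_sqr -poweRrM divff// poweRe1// Lnorm_ge0. Qed.

Lemma Lnorm2_le (f : T -> R) (C : R) : 0 <= C ->
  (nm f <= C%:E)%E = (\int[mu]_x (f x ^+ 2)%:E <= (C ^+ 2)%:E)%E.
Proof.
move=> C0; have i0 : (0 <= \int[mu]_x (f x ^+ 2)%:E)%E.
  by apply: integral_ge0 => x _; rewrite lee_fin sqr_ge0.
apply/idP/idP => h.
  rewrite -Lnorm2_sqr (_ : (C ^+ 2)%:E = C%:E `^ 2)%E; last first.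
    by rewrite poweR_EFin powR_mulrn.
  by apply: gt0_ler_poweR => //; rewrite in_itv/= leey ?Lnorm_ge0// lee_fin C0.
rewrite Lnorm2E (_ : C%:E = (C ^+ 2)%:E `^ 2^-1)%E; last first.
  by rewrite poweR_EFin -powR_mulrn// -powRrM divff// powRr1.
apply: gt0_ler_poweR => //; rewrite in_itv/= leey ?andbT//.
by rewrite lee_fin sqr_ge0.
Qed.

Definition L2nm (u : L) : R := fine (nm u).

Lemma L2nmE u : (L2nm u)%:E = nm u. Proof. exact: finite_norm_fine. Qed.

Lemma L2nm_ge0 u : 0 <= L2nm u.
Proof. by rewrite -lee_fin L2nmE Lnorm_ge0. Qed.

Lemma L2nm_le u C : 0 <= C ->
  (L2nm u <= C) = (\int[mu]_x (u x ^+ 2)%:E <= (C ^+ 2)%:E)%E.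
Proof. by move=> C0; rewrite -Lnorm2_le// -L2nmE lee_fin. Qed.

Lemma L2nm_seminorm : is_seminorm L2nm.
Proof.
split=> [u v|a u]; first exact: ler_LnormD.
by apply: EFin_inj; rewrite EFinM !L2nmE -LnormZ.
Qed.

Lemma mem_Lfun2 (f : T -> R) : measurable_fun [set: T] f ->
  (nm f < +oo)%E -> f \in Lfun mu 2%:R%:E.
Proof.
move=> mf foo; apply/andP; split; rewrite inE//=.
Qed.

(** Since the k-th increment has norm at most 4^-k, the function
    S = sum_k 4^k |x_{k+1} - x_k|^2 has a finite integral and is finite almost
    everywhere; where it is finite the increments are O(2^-k), so the sequence
    converges pointwise.  By Fatou's lemma the pointwise limit is at the required
    distance from x_k. *)
Lemma L2_rapidly_complete : rapidly_complete L2nm.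
Proof.
move=> x xc.
have mx k : measurable_fun [set: T] (x k) by [].
have xmk m k : L2nm (x (k + m)%N - x k) <= 4 / 3 * 4^-1 ^+ k.
  suff : L2nm (x (k + m)%N - x k) <= 4 / 3 * 4^-1 ^+ k * (1 - 4^-1 ^+ m).
    move=> /le_trans; apply; rewrite ler_piMr// ?mulr_ge0//.
  elim: m => [|m IH].
    by rewrite addn0 subrr (seminorm0 L2nm_seminorm) expr0 subrr mulr0.
  apply: (le_trans (seminorm_trans L2nm_seminorm (x (k + m)%N) _ _)).
  rewrite addnS; apply: (le_trans (lerD (xc _) IH)).
  by rewrite exprD exprS; lra.
(* The weight 4^k leaves a convergent bound: the k-th term has integral at most
   4^k (4^-k)^2 = 4^-k. *)
pose e k (y : T) : \bar R := (4 ^+ k * (x k.+1 y - x k y) ^+ 2)%:E.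
have me k : measurable_fun [set: T] (e k).
  apply/measurable_EFinP/measurable_funM => //; apply/measurable_funX.
  exact: measurable_funB.
have e0 k y : (0 <= e k y)%E.
  by rewrite lee_fin; apply: mulr_ge0; [exact: exprn_ge0|exact: sqr_ge0].
pose S y := (\sum_(0 <= k <oo) e k y)%E.
have mS : measurable_fun [set: T] S by exact: ge0_emeasurable_sum.
have S0 y : (0 <= S y)%E by apply: nneseries_ge0.
have iS : (\int[mu]_y S y < +oo)%E.
  rewrite integral_nneseries//.
  apply: (@le_lt_trans _ _ (\sum_(0 <= k <oo) (4^-1 ^+ k)%:E)%E).
    apply: lee_nneseries => [k _ _|k _]; first exact: integral_ge0.
    rewrite /e; under eq_integral do rewrite EFinM.
    rewrite ge0_integralZl//; last first.
    - by move=> y _; rewrite lee_fin sqr_ge0.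
    - by apply/measurable_EFinP/measurable_funX/measurable_funB.
    rewrite (_ : 4^-1 ^+ k = 4 ^+ k * (4^-1 ^+ k) ^+ 2); last first.
      by rewrite expr2 mulrA -exprMn divff// expr1n mul1r.
    rewrite EFinM lee_pmul2l// ?lte_fin ?exprn_gt0//.
    by rewrite -(L2nm_le (x k.+1 - x k))// xc.
  apply: (@le_lt_trans _ _ (4 / 3)%:E); last exact: ltry.
  apply: lime_le; first by apply: is_cvg_nneseries => k _ _; rewrite lee_fin.
  apply: nearW => m; rewrite sumEFin lee_fin.
  suff -> : \sum_(0 <= k < m) 4^-1 ^+ k = 4 / 3 * (1 - 4^-1 ^+ m) :> R.
    by rewrite ler_piMr// lerBlDr lerDl.
  elim: m => [|m IH]; first by rewrite big_geq// expr0 subrr mulr0.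
  by rewrite big_nat_recr//= IH exprS; field.
pose A := [set y | (S y < +oo)%E].
have mA : measurable A.
  by rewrite -[A]setTI; apply: emeasurable_fun_infty_o.
have A0 : mu (~` A) = 0.
  have : mu.-integrable [set: T] S.
    by apply/integrableP; split => //; under eq_integral do rewrite gee0_abs//.
  move=> /(integrable_ae measurableT)[B [mB B0 AB]].
  apply/eqP; rewrite -measure_le0 -B0; apply: le_measure; rewrite ?inE//.
    exact: measurableC.
  move=> y /= Ay; apply: AB => /= /(_ I) Sy; apply: Ay => /=.
  by rewrite /A/= -ge0_fin_numE.
have cA y : A y -> cvgn (x^~ y).
  move=> Ay; pose C := fine (S y).
  have SC : S y = C%:E by rewrite fineK// ge0_fin_numE.
  have C0 : 0 <= C by rewrite -lee_fin -SC.
  have dC k : `|telescope (x^~ y) k| <= geometric (Num.sqrt C) 2^-1 k.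
    have : (e k y <= C%:E)%E.
      rewrite -SC; have := @nneseries_lim_ge _ (e^~ y) xpredT 0 k.+1.
      move=> /(_ (fun k _ _ => e0 k y)); apply: le_trans.
      by rewrite big_nat_recr//= leeDr// sume_ge0.
    rewrite lee_fin /telescope /= => h.
    rewrite -(@ler_pXn2r _ 2) ?nnegrE ?mulr_ge0 ?sqrtr_ge0//.
    rewrite real_normK ?num_real// exprMn sqr_sqrtr// -exprM mulnC exprM.
    rewrite (_ : 2^-1 ^+ 2 = 4^-1); last by field.
    by rewrite exprVn ler_pdivlMr ?exprn_gt0// mulrC.
  have cs : cvgn (series (telescope (x^~ y))).
    apply: normed_cvg.
    apply: (series_le_cvg _ _ dC) => [k|k|]; first exact: normr_ge0.
      by rewrite /geometric/= mulr_ge0 ?sqrtr_ge0.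
    by apply: is_cvg_geometric_series; rewrite gtr0_norm//; lra.
  have -> : x^~ y = (fun n => x 0%N y + series (telescope (x^~ y)) n).
    by apply/funext => k; rewrite -eq_sum_telescope.
  apply: is_cvgD => //; exact: is_cvg_cst.
pose X y := limn (fun k => x k y * \1_A y).
have cX y : x k y * \1_A y @[k --> \oo] --> X y.
  suff : cvgn (fun k => x k y * \1_A y) by [].
  rewrite indicE; have [yA|yA] := boolP (y \in A).
    by under eq_fun do rewrite mulr1; apply: cA; rewrite inE in yA.
  by under eq_fun do rewrite mulr0; exact: is_cvg_cst.
have mX : measurable_fun [set: T] X.
  apply: (@measurable_fun_cvg _ _ _ _ (fun k y => x k y * \1_A y)) => // k.
  by apply: measurable_funM => //; exact: measurable_indic.
have Xk k : (\int[mu]_y ((X y - x k y) ^+ 2)%:E <= ((4 / 3 * 4^-1 ^+ k) ^+ 2)%:E)%E.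
  rewrite (ge0_negligible_integral (N := ~` A))//; last 3 first.
  - exact: measurableC.
  - by apply/measurable_EFinP/measurable_funX/measurable_funB.
  - by move=> y _; rewrite lee_fin sqr_ge0.
  rewrite setTD setCK.
  pose f m y := ((x (k + m)%N y - x k y) ^+ 2)%:E.
  have mf m : measurable_fun A (f m).
    by apply/measurable_funTS/measurable_EFinP/measurable_funX/measurable_funB.
  have f0 m y : (0 <= f m y)%E by rewrite lee_fin sqr_ge0.
  have -> : (\int[mu]_(y in A) ((X y - x k y) ^+ 2)%:E =
             \int[mu]_(y in A) limn_einf (f^~ y))%E.
    apply: eq_integral => y yA.
    suff /cvg_limn_einf_sup[-> _] : f^~ y @ \oo --> ((X y - x k y) ^+ 2)%:E by [].
    apply: cvg_EFin; first exact: nearW.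
    apply: (@cvg_comp _ _ _ (fun m => x (k + m)%N y - x k y) (fun z => z ^+ 2)); last first.
      exact: exprn_continuous.
    apply: cvgB; last exact: cvg_cst.
    have := cX y; rewrite indicE yA; under eq_fun do rewrite mulr1.
    move=> h; under eq_fun do rewrite addnC.
    by move: h; rewrite -(cvg_shiftn k).
  apply: (le_trans (fatou mu mA mf _)) => //.
  rewrite limn_einf_lim; apply: lime_le; first exact: is_cvg_einfs.
  apply: nearW => m; apply: (@le_trans _ _ (\int[mu]_(y in A) f m y)%E).
    by apply: ereal_inf_lbound; exists m => /=.
  apply: (@le_trans _ _ (\int[mu]_y f m y)%E).
    by apply: ge0_subset_integral => //; apply/measurable_EFinP/measurable_funX/measurable_funB.
  by rewrite -(L2nm_le (x (k + m)%N - x k))// mulr_ge0.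
have X2 : X \in Lfun mu 2%:R%:E.
  apply: mem_Lfun2 => //.
  have -> : X = (fun y => (X y - x 0%N y) + x 0%N y) by apply/funext => y; rewrite subrK.
  apply: (le_lt_trans (eminkowski _ _ _ _)) => //.
    exact: measurable_funB.
    by rewrite lee_fin; lra.
  apply: lte_add_pinfty; last exact: Lfunction_finite.
  apply: (@le_lt_trans _ _ (4 / 3)%:E); last exact: ltry.
  by rewrite Lnorm2_le//; have := Xk 0; rewrite expr0 mulr1.
by exists (Lfun_Sub _ X2) => k; rewrite L2nm_le ?mulr_ge0//; exact: Xk.
Qed.
End L2_complete.

(** * Integration against a measure with a density *)

Section density.
Import HBNNSimple.
Variables (d : measure_display) (T : measurableType d) (R : realType).
Variables (mu nu : {measure set T -> \bar R}) (w : T -> R).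
Hypotheses (w0 : forall x, 0 <= w x) (mw : measurable_fun [set: T] w).
Hypothesis nuE : forall A, measurable A -> nu A = (\int[mu]_(x in A) (w x)%:E)%E.
Local Open Scope ereal_scope.

(** Both sides are limits along the simple functions that approximate f from
    below, so the claim reduces to indicator functions, where it is the
    hypothesis on nu. *)
Lemma ge0_integral_density (f : T -> \bar R) : (forall x, 0 <= f x) ->
  measurable_fun [set: T] f ->
  \int[nu]_x f x = \int[mu]_x (f x * (w x)%:E).
Proof.
move=> f0 mf; pose h := nnsfun_approx measurableT mf.
have hf x : (EFin \o h n) x @[n --> \oo] --> f x by exact: cvg_nnsfun_approx.
have -> : \int[nu]_x f x = limn (fun n => \int[nu]_x (EFin \o h n) x).
  rewrite -monotone_convergence//.
  - by apply: eq_integral => x _; apply/esym/cvg_lim.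
  - by move=> n; apply/measurable_EFinP.
  - by move=> n x _; rewrite lee_fin.
  - by move=> x _ a b ab; rewrite lee_fin; exact/lefP/nd_nnsfun_approx.
have -> : \int[mu]_x (f x * (w x)%:E) =
    limn (fun n => \int[mu]_x ((EFin \o h n) x * (w x)%:E)).
  rewrite -monotone_convergence//.
  - apply: eq_integral => x _; apply/esym/cvg_lim => //.
    by apply: cvgeZr => //; exact: hf.
  - by move=> n; apply/measurable_EFinP/measurable_funM.
  - by move=> n x _; rewrite lee_fin mulr_ge0.
  - move=> x _ a b ab; rewrite lee_fin ler_wpM2r//.
    exact/lefP/nd_nnsfun_approx.
congr (limn _); apply/funext => n.
have mA r : measurable (h n @^-1` [set r]) by [].
transitivity (\sum_(r \in range (h n)) \int[nu]_x (r * \1_(h n @^-1` [set r]) x)%:E).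
  rewrite -ge0_integral_fsum//.
  - by apply: eq_integral => x _; rewrite /= fimfunE -fsumEFin.
  - by move=> r; apply/measurable_EFinP/measurable_funM => //; exact: measurable_indic.
  - by move=> m y _; exact: nnfun_muleindic_ge0.
transitivity (\sum_(r \in range (h n))
    \int[mu]_x ((r * \1_(h n @^-1` [set r]) x)%:E * (w x)%:E)); last first.
  rewrite -ge0_integral_fsum//.
  - apply: eq_integral => x _.
    rewrite -ge0_mule_fsuml => [|y]; last exact: nnfun_muleindic_ge0.
    by rewrite fsumEFin// -(fimfunE _ x).
  - move=> r; apply/measurable_EFinP/measurable_funM => //.
    by apply: measurable_funM => //; exact: measurable_indic.
  - by move=> m y _; rewrite mule_ge0 ?lee_fin// -lee_fin nnfun_muleindic_ge0.
apply: eq_fsbigr => r rhn.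
have r0 : (0 <= r)%R by move: rhn; rewrite inE => -[t _ <-].
under eq_integral do rewrite EFinM.
rewrite ge0_integralZl//; last by apply/measurable_EFinP; exact: measurable_indic.
rewrite integral_indic// setIT nuE//.
under [RHS]eq_integral do rewrite EFinM -muleA.
rewrite ge0_integralZl//; last 2 first.
  - apply/measurable_EFinP/measurable_funM => //; exact: measurable_indic.
  - by move=> x _; rewrite mule_ge0// lee_fin.
congr (_ * _); rewrite integral_mkcond; apply: eq_integral => x _.
by rewrite epatch_indic muleC.
Qed.

Lemma integral_density (f : T -> R) : measurable_fun [set: T] f ->
  \int[nu]_x (f x)%:E = \int[mu]_x (f x * w x)%:E.
Proof.
move=> mf; rewrite integralE [RHS]integralE.
have mEf : measurable_fun [set: T] (EFin \o f) by exact/measurable_EFinP.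
rewrite !ge0_integral_density//; last 2 first.
  exact: measurable_funeneg.
  exact: measurable_funepos.
congr (_ - _); apply: eq_integral => x _.
  by rewrite !funeposE EFinM maxe_pMl ?mul0e ?lee_fin.
by rewrite !funenegE EFinM -mulNe maxe_pMl ?mul0e ?lee_fin.
Qed.

End density.

(** * Lebesgue and Gaussian-weighted measures on R^n *)

Section lebesgue_rV.
Local Open Scope ereal_scope.
Variable R : realType.

Lemma ge0_integral_rV_cons n (F : 'rV[R]_n.+1 -> \bar R) :
  measurable_fun [set: 'rV[R]_n.+1] F -> (forall y, 0 <= F y) ->
  \int[lebesgue_rV R n.+1]_y F y =
  \int[lebesgue_measure]_x \int[lebesgue_rV R n]_y F (rV_cons (x, y)).
Proof.
move=> mF F0.
transitivity (\int[(lebesgue_measure \x lebesgue_rV R n)%E]_p F (rV_cons p)).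
  change (\int[pushforward (lebesgue_measure \x lebesgue_rV R n) (@rV_cons R n)]_y F y =
    \int[(lebesgue_measure \x lebesgue_rV R n)%E]_p F (rV_cons p)).
  rewrite ge0_integral_pushforward ?preimage_setT//.
  exact: measurable_rV_cons.
rewrite fubini_tonelli1//.
exact: measurableT_comp mF (@measurable_rV_cons R n).
Qed.

(** The density of the centred normal law of variance 1 / (2 a) has integral 1. *)
Lemma integral_gauss (a : R) : (0 < a)%R ->
  \int[lebesgue_measure]_x (expR (- (a * x ^+ 2)))%:E = (Num.sqrt (pi / a))%:E.
Proof.
move=> a0; pose s := Num.sqrt (2 * a)^-1.
have s2 : (s ^+ 2 = (2 * a)^-1)%R by rewrite sqr_sqrtr// invr_ge0 mulr_ge0// ltW.
have s0 : s != 0%R by rewrite sqrtr_eq0 -ltNge invr_gt0 mulr_gt0.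
have := integral_normal_pdf 0 s; under eq_integral do rewrite normal_pdfE// EFinM.
have p0 := normal_peak_gt0 s0.
rewrite ge0_integralZl//; last 3 first.
- by apply/measurable_EFinP; exact: measurable_normal_fun.
- by move=> x _; rewrite lee_fin expR_ge0.
- by rewrite lee_fin ltW.
rewrite /normal_peak /normal_fun.
under eq_integral => x _.
  rewrite subr0 s2 (_ : (- x ^+ 2 / ((2 * a)^-1 *+ 2) = - (a * x ^+ 2))%R).
    over.
  by field; rewrite gt_eqF.
rewrite s2 (_ : ((2 * a)^-1 * pi *+ 2 = pi / a)%R); last by field; rewrite gt_eqF.
have P0 : (0 < Num.sqrt (pi / a))%R by rewrite sqrtr_gt0 divr_gt0// pi_gt0.
move=> H; rewrite -[LHS]mul1e -[X in X%:E](@divff _ (Num.sqrt (pi / a))) ?gt_eqF//.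
by rewrite EFinM -muleA H mule1.
Qed.

Definition sqnorm n (y : 'rV[R]_n) : R := (\sum_(i < n) y ord0 i ^+ 2)%R.

Lemma measurable_sqnorm n : measurable_fun [set: 'rV[R]_n] (@sqnorm n).
Proof.
apply: measurable_sum => i; apply: measurable_funX; exact: measurable_rV_coord.
Qed.

Lemma sqnorm_ge0 n (y : 'rV[R]_n) : (0 <= sqnorm y)%R.
Proof. by apply: sumr_ge0 => i _; exact: sqr_ge0. Qed.

Lemma sqnorm_cons n (x : R) (y : 'rV[R]_n) :
  (sqnorm (rV_cons (x, y)) = x ^+ 2 + sqnorm y)%R.
Proof.
rewrite /sqnorm big_ord_recl; congr (_ ^+ 2 + _)%R.
  by rewrite mxE unlift_none.
by apply: eq_bigr => i _; rewrite mxE liftK.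
Qed.

Lemma measurable_expR_sqnorm n (a : R) :
  measurable_fun [set: 'rV[R]_n] (fun y => expR (a * sqnorm y)%R).
Proof.
apply: measurableT_comp => //; apply: measurable_funM => //.
exact: measurable_sqnorm.
Qed.

Lemma measurable_gauss n (a : R) : measurable_fun [set: 'rV[R]_n]
  (fun y => (expR (- (a * sqnorm y)))%:E).
Proof.
apply/measurable_EFinP; under eq_fun do rewrite -mulNr.
exact: measurable_expR_sqnorm.
Qed.

Lemma integral_gauss_rV n (a : R) : (0 < a)%R ->
  \int[lebesgue_rV R n]_y (expR (- (a * sqnorm y)))%:E =
  (Num.sqrt (pi / a) ^+ n)%:E.
Proof.
move=> a0; elim: n => [|n IH].
  rewrite integral_dirac//; last exact: measurable_gauss.
  by rewrite diracT mul1e /sqnorm big_ord0 mulr0 oppr0 expR0.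
rewrite ge0_integral_rV_cons; [|exact: measurable_gauss|].
  under eq_integral => x _.
    under eq_integral do rewrite sqnorm_cons mulrDr opprD expRD EFinM.
    rewrite (ge0_integralZl _ measurableT (@measurable_gauss n a)); last 2 first.
    - by move=> y _; rewrite lee_fin expR_ge0.
    - by rewrite lee_fin expR_ge0.
    rewrite IH; over.
  rewrite ge0_integralZr//.
  - by rewrite integral_gauss// -EFinM -exprS.
  - apply/measurable_EFinP/measurableT_comp => //; apply: measurableT_comp => //.
    by apply: measurable_funM => //; exact: measurable_funX.
by move=> y; rewrite lee_fin expR_ge0.
Qed.

End lebesgue_rV.

Section weighted_measure.
Local Open Scope ereal_scope.
Variables (R : realType) (n : nat) (s : R).
Local Notation E := 'rV[R]_n.

Lemma potentialE (y : E) : potential y = (sqnorm y / 4)%R.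
Proof. by []. Qed.

Let w (y : E) : R := expR (- (potential y / s)).
Let w0 (y : E) : (0 <= w y)%R. Proof. exact: expR_ge0. Qed.

Let mw : measurable_fun [set: E] w.
Proof.
apply: measurableT_comp => //; apply: measurableT_comp => //.
by apply: measurable_funM => //; exact: measurable_potential.
Qed.

Lemma ge0_integral_weighted (f : E -> \bar R) : (forall y, 0 <= f y) ->
  measurable_fun [set: E] f ->
  \int[weighted_measure s]_y f y =
  \int[lebesgue_rV R n]_y (f y * (expR (- (potential y / s)))%:E).
Proof.
by move=> f0 mf; apply: (@ge0_integral_density _ _ _ (lebesgue_rV R n)
  (weighted_measure s) w w0 mw).
Qed.

Lemma integral_weighted (f : E -> R) : measurable_fun [set: E] f ->
  \int[weighted_measure s]_y (f y)%:E =
  \int[lebesgue_rV R n]_y (f y * expR (- (potential y / s)))%:E.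
Proof.
by move=> mf; apply: (@integral_density _ _ _ (lebesgue_rV R n)
  (weighted_measure s) w w0 mw).
Qed.

End weighted_measure.

(** * Borel measurability of continuous functions on R^n *)

Section continuous_measurable.
Variables (R : realType) (n : nat).

Let grid (k : nat) (y : 'rV[R]_n) : 'rV[int]_n :=
  \row_i Num.floor (k.+1%:R * y ord0 i).
Let node (k : nat) (z : 'rV[int]_n) : 'rV[R]_n :=
  \row_i ((z ord0 i)%:~R / k.+1%:R).

Let cvg_node y : node k (grid k y) @[k --> \oo] --> y.
Proof.
apply/cvg_ballP => e e0; near=> k; split => // i j.
rewrite !mxE ord1 /ball/= ltr_norml.
have k0 : 0 < k.+1%:R :> R by [].
set x := y ord0 j; have /andP[f1 f2] := floor_itv (k.+1%:R * x).
have ke : k.+1%:R^-1 < e.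
  near: k; exact: near_infty_natSinv_lt (PosNum e0).
rewrite intrD in f2.
rewrite -(ltr_pM2r k0) -(ltr_pM2r k0 _ e) mulrBl divfK ?gt_eqF//.
have : 1 < e * k.+1%:R by rewrite -ltr_pdivrMr// div1r.
move=> ek; apply/andP; split; lra.
Unshelve. all: by end_near. Qed.

Let measurable_grid k z : measurable [set y | grid k y = z].
Proof.
rewrite (_ : [set y | _] = \bigcap_(i in [set: 'I_n])
    (rV_coord i @^-1` `[(z ord0 i)%:~R / k.+1%:R, ((z ord0 i)%:~R + 1) / k.+1%:R[)).
  apply: fin_bigcap_measurable => // i _.
  by rewrite -[X in measurable X]setTI; apply: measurable_rV_coord.
have k0 : 0 < k.+1%:R :> R by [].
apply/seteqP; split => y /=.
  move=> <- i _; rewrite /= in_itv/= /rV_coord mxE.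
  rewrite ler_pdivrMr// ltr_pdivlMr// mulrC.
  by have := floor_itv (y 0 i * k.+1%:R); rewrite intrD.
move=> H; apply/rowP => i; have := H i I; rewrite /= in_itv/= /rV_coord mxE.
rewrite ler_pdivrMr// ltr_pdivlMr// mulrC => h.
by apply: floor_def; rewrite intrD.
Qed.

(** The sigma-algebra is generated by the coordinates, while continuity refers to
    the product topology.  A continuous function is the pointwise limit of its
    compositions with the rounding of every coordinate down to a multiple of
    1 / (k + 1); these are constant on each of countably many boxes. *)
Lemma continuous_measurable_rV (phi : 'rV[R]_n -> R) : continuous phi ->
  measurable_fun [set: 'rV[R]_n] phi.
Proof.
move=> cphi; apply: (@measurable_fun_cvg _ _ _ _ (fun k y => phi (node k (grid k y)))).
  move=> k _ Y mY; rewrite setTI.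
  rewrite (_ : _ @^-1` _ = \bigcup_(z in [set z | Y (phi (node k z))])
      [set y | grid k y = z]); last first.
    apply/seteqP; split=> [y /= Yy|y [z /= Yz ->]//].
    by exists (grid k y).
  rewrite bigcup_mkcond; apply: countable_bigcupT_measurable => // z.
  by case: ifP.
by move=> y _; apply: continuous_cvg; [exact: cphi|exact: cvg_node].
Qed.

End continuous_measurable.

(** * Compactly supported functions and integration along lines *)

Definition set_coord (R : realType) (n : nat) (i : 'I_n) (x : R)
    (y : 'rV[R]_n) : 'rV[R]_n :=
  \row_j (if j == i then x else y ord0 j).

Section set_coord.
Variable R : realType.

Lemma set_coord0_cons n (x a : R) (y : 'rV[R]_n) :
  set_coord ord0 x (rV_cons (a, y)) = rV_cons (x, y).
Proof.
apply/rowP => j; rewrite !mxE; case: unliftP => [k ->|->]; last by rewrite eqxx.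
by rewrite eq_sym (negbTE (neq_lift _ _)).
Qed.

Lemma set_coord_lift_cons n (i : 'I_n) (x a : R) (y : 'rV[R]_n) :
  set_coord (lift ord0 i) x (rV_cons (a, y)) = rV_cons (a, set_coord i x y).
Proof.
apply/rowP => j; rewrite !mxE; case: unliftP => [k ->|->].
  by rewrite (inj_eq lift_inj) mxE.
by rewrite (negbTE (neq_lift _ _)).
Qed.

Lemma set_coordE n (i : 'I_n) (x : R) (y : 'rV[R]_n) :
  set_coord i x y = (x - y ord0 i) *: delta_mx 0 i + y.
Proof.
apply/rowP => j; rewrite !mxE eqxx/=; case: eqP => [->|_].
  by rewrite mulr1 subrK.
by rewrite mulr0 add0r.
Qed.

Lemma integral_rV_cons n (F : 'rV[R]_n.+1 -> \bar R) :
  (lebesgue_rV R n.+1).-integrable [set: 'rV[R]_n.+1] F ->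
  (lebesgue_measure \x lebesgue_rV R n)%E.-integrable [set: R * 'rV[R]_n]
    (F \o @rV_cons R n) /\
  (\int[lebesgue_rV R n.+1]_y F y =
   \int[lebesgue_measure \x lebesgue_rV R n]_p F (rV_cons p))%E.
Proof.
move=> /integrableP[mF Foo].
have iF : (lebesgue_measure \x lebesgue_rV R n)%E.-integrable [set: R * 'rV[R]_n]
    (F \o @rV_cons R n).
  apply/integrableP; split; first exact: measurableT_comp mF (@measurable_rV_cons R n).
  move: Foo; change ((\int[pushforward (lebesgue_measure \x lebesgue_rV R n) (@rV_cons R n)]_y `|F y| < +oo)%E ->
   (\int[(lebesgue_measure \x lebesgue_rV R n)%E]_p `|F (rV_cons p)| < +oo)%E).
  rewrite ge0_integral_pushforward ?preimage_setT//; first exact: measurable_rV_cons.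
  exact: measurableT_comp.
split => //.
change (\int[pushforward (lebesgue_measure \x lebesgue_rV R n) (@rV_cons R n)]_y F y =
    \int[(lebesgue_measure \x lebesgue_rV R n)%E]_p F (rV_cons p))%E.
rewrite integral_pushforward ?preimage_setT//.
exact: measurable_rV_cons.
Qed.

(** Fubini along a coordinate i other than the one split off by rV_cons: for i = 0
    the inner integral is the one over a line, otherwise the induction hypothesis
    applies to almost every slice. *)
Lemma integral_lines0 n (i : 'I_n) (G : 'rV[R]_n -> \bar R) :
  (lebesgue_rV R n).-integrable [set: 'rV[R]_n] G ->
  (forall y, \int[lebesgue_measure]_x G (set_coord i x y) = 0)%E ->
  (\int[lebesgue_rV R n]_y G y = 0)%E.
Proof.
elim: n i G => [[]//|n IH] i G iG G0.
have [iGc ->] := integral_rV_cons iG.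
case: (unliftP ord0 i) G0 => [j ->|->] G0; last first.
  rewrite -integral21_prod_meas1//; apply: integral0_eq => y _.
  rewrite /fubini_G -[RHS](G0 (rV_cons (0, y))).
  by apply: eq_integral => x _; rewrite set_coord0_cons.
rewrite -integral12_prod_meas1// -[RHS](@integral0 _ _ _ lebesgue_measure setT).
apply: ae_eq_integral => //; first exact: measurable_fubini_F iGc.
have := ae_integrable1 iGc; apply: filterS => x iGx _.
by rewrite /fubini_F; apply: (IH j) => // y; under eq_integral do rewrite -set_coord_lift_cons.
Qed.

End set_coord.

Section compact_support.
Variables (R : realType) (n : nat).
Local Notation E := 'rV[R]_n.

Definition compactly_supported (h : E -> R) :=
  exists2 K : set E, compact K & forall y, ~ K y -> h y = 0.

Lemma compact_coord_bound (K : set E) : compact K ->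
  exists2 B : R, 0 < B & forall y, K y -> forall i, `|y ord0 i| < B.
Proof.
move=> /compact_bounded[M [_ KM]]; exists (`|M| + 2) => [|y Ky i].
  by have := normr_ge0 M; lra.
apply: (@le_lt_trans _ _ (`|M| + 1)); last by lra.
apply: le_trans (KM (`|M| + 1) _ y Ky); last first.
  by rewrite (le_lt_trans (ler_norm _))// ltrDl.
rewrite [leRHS]/Num.norm/= mx_normrE; apply/bigmax_geP; right => /=.
by exists (ord0, i).
Qed.

Lemma compactly_supported_bounded (h : E -> R) : continuous h ->
  compactly_supported h -> exists M, forall y, `|h y| <= M.
Proof.
move=> ch [K cK h0].
have /compact_bounded[M [_ hM]] : compact [set h y | y in K].
  by apply: continuous_compact => //; exact: continuous_subspaceT.
exists (`|M| + 1) => y; have [Ky|Ky] := pselect (K y).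
  by apply: hM; [rewrite (le_lt_trans (ler_norm _))// ltrDl|exists y].
by rewrite h0// normr0; have := normr_ge0 M; lra.
Qed.

Lemma continuous_mul (f g : E -> R) : continuous f -> continuous g ->
  continuous (fun y => f y * g y).
Proof. by move=> cf cg y; apply: continuousM; [exact: cf|exact: cg]. Qed.

Lemma continuous_add (f g : E -> R) : continuous f -> continuous g ->
  continuous (fun y => f y + g y).
Proof. by move=> cf cg y; apply: continuousD; [exact: cf|exact: cg]. Qed.

Lemma continuous_sub (f g : E -> R) : continuous f -> continuous g ->
  continuous (fun y => f y - g y).
Proof. by move=> cf cg y; apply: continuousB; [exact: cf|exact: cg]. Qed.

Lemma continuous_sqnorm : continuous (@sqnorm R n).
Proof.
apply: continuous_big => [|i _ y]; first exact: add_continuous.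
apply: (@cvg_comp _ _ _ (fun y : E => y ord0 i) (fun z => z ^+ 2)).
  exact: coord_continuous.
exact: exprn_continuous.
Qed.

Lemma continuous_gauss (a : R) : continuous (fun y : E => expR (a * sqnorm y)).
Proof.
have ca : continuous (fun y : E => a * sqnorm y).
  by apply: continuous_mul; [exact: cst_continuous|exact: continuous_sqnorm].
by move=> y; apply: continuous_comp; [exact: ca|exact: continuous_expR].
Qed.

Lemma integrable_gauss_rV (a : R) : 0 < a ->
  (lebesgue_rV R n).-integrable [set: E] (fun y => (expR (- (a * sqnorm y)))%:E).
Proof.
move=> a0; apply/integrableP; split; first exact: measurable_gauss.
under eq_integral do rewrite gee0_abs ?lee_fin ?expR_ge0//.
by rewrite integral_gauss_rV// ltry.
Qed.

(** h (y) e^{|y|^2} is again continuous with compact support, hence bounded, so that h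
    is dominated by a multiple of e^{-|y|^2}. *)
Lemma compactly_supported_integrable (h : E -> R) : continuous h ->
  compactly_supported h ->
  (lebesgue_rV R n).-integrable [set: E] (EFin \o h).
Proof.
move=> ch [K cK h0].
have [M hM] : exists M, forall y, `|h y * expR (1 * sqnorm y)| <= M.
  apply: compactly_supported_bounded; last first.
    by exists K => // y Ky; rewrite h0// mul0r.
  by apply: continuous_mul => //; exact: continuous_gauss.
apply: (@le_integrable _ _ _ _ _ _ _ (fun y => M%:E * (expR (- (1 * sqnorm y)))%:E)%E) => //.
- by apply/measurable_EFinP; apply: continuous_measurable_rV; exact: ch.
- move=> y _; rewrite lee_fin; apply: le_trans (ler_norm _).
  rewrite expRN -[leLHS](mulfK (lt0r_neq0 (expR_gt0 (1 * sqnorm y)))).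
  by rewrite ler_pM2r ?invr_gt0 ?expR_gt0// -[X in _ * X]gtr0_norm ?expR_gt0// -normrM.
- by apply: integrableZl => //; exact: integrable_gauss_rV.
Qed.

Lemma is_derive_line (u : E -> R) (i : 'I_n) (y : E) (x : R) :
  derivable u (set_coord i x y) (delta_mx 0 i) ->
  is_derive x (1 : R) (fun x => u (set_coord i x y)) (partial i u (set_coord i x y)).
Proof.
have lineE h : set_coord i (h *: 1 + x) y = h *: delta_mx 0 i + set_coord i x y.
  by rewrite !set_coordE addrA -scalerDl; congr (_ *: _ + _); rewrite /GRing.scale/=; ring.
move=> du; split.
  rewrite /derivable/=; under eq_fun do rewrite lineE; exact: du.
by rewrite /partial /derive/=; under eq_fun do rewrite lineE.
Qed.

Lemma integral_derive0 (F f : R -> R) (B : R) : 0 < B ->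
  (forall x, is_derive x (1 : R) F (f x)) -> continuous f ->
  (forall x, B <= `|x| -> F x = 0) -> (forall x, B <= `|x| -> f x = 0) ->
  (\int[lebesgue_measure]_x (f x)%:E = 0)%E.
Proof.
move=> B0 dF cf F0 f0.
have dF1 x : derivable F x 1 by case: (dF x).
have cF : continuous F by move=> x; apply/differentiable_continuous/derivable1_diffP.
transitivity (\int[lebesgue_measure]_(x in `[(- B)%R, B]) (f x)%:E)%E.
  rewrite [RHS]integral_mkcond; apply: eq_integral => x _.
  rewrite patchE; case: ifPn => //; rewrite notin_setE/= in_itv/= => /negP xB.
  by rewrite f0// leNgt; apply: contra xB; rewrite ltr_norml => /andP[/ltW -> /ltW].
rewrite (@continuous_FTC2 _ f F)//.
- by rewrite !F0 ?normrN ?gtr0_norm// subee.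
- by lra.
- exact: continuous_subspaceT.
- by split => //; [apply: cvg_at_right_filter|apply: cvg_at_left_filter]; exact: cF.
- by move=> x _; rewrite derive1E; case: (dF x).
Qed.

End compact_support.

(** * The drift Laplacian of a Gaussian in the sense of distributions *)

Section gaussian.
Variables (R : realType) (n : nat).
Local Notation E := 'rV[R]_n.

Definition gaussian (c b : R) (y : E) : R := expR (c + b * sqnorm y).

Lemma gaussianE c b y : gaussian c b y = expR c * expR (b * sqnorm y).
Proof. exact: expRD. Qed.

Lemma continuous_gaussian c b : continuous (gaussian c b).
Proof.
rewrite (_ : gaussian c b = fun y => expR c * expR (b * sqnorm y)); last first.
  by apply/funext => y; rewrite gaussianE.
by apply: continuous_mul; [exact: cst_continuous|exact: continuous_gauss].
Qed.

Lemma measurable_gaussian c b : measurable_fun [set: E] (gaussian c b).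
Proof. by apply: continuous_measurable_rV; exact: continuous_gaussian. Qed.

Lemma continuous_coord (i : 'I_n) : continuous (fun y : E => y ord0 i).
Proof. by move=> y; exact: coord_continuous. Qed.

Lemma sqnorm_set_coord (i : 'I_n) (x : R) (y : E) :
  sqnorm (set_coord i x y) = x ^+ 2 + (sqnorm y - y ord0 i ^+ 2).
Proof.
rewrite /sqnorm (bigD1 i)//= [in RHS](bigD1 i)//= mxE eqxx addrAC subrr add0r.
by congr (_ + _); apply: eq_bigr => j ji; rewrite mxE (negbTE ji).
Qed.

Lemma continuous_set_coord (i : 'I_n) (y : E) :
  continuous (fun x : R => set_coord i x y).
Proof.
have -> : (fun x : R => set_coord i x y) =
    (fun x => (x - y ord0 i) *: delta_mx 0 i + y).
  by apply/funext => x; rewrite set_coordE.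
move=> x; apply: cvgD; last exact: cvg_cst.
apply: cvgZr_tmp; apply: cvgB; [exact: cvg_id|exact: cvg_cst].
Qed.

Lemma partial_eq0 (i : 'I_n) (u : E -> R) (K : set E) : closed K ->
  (forall y, ~ K y -> u y = 0) -> forall y, ~ K y -> partial i u y = 0.
Proof.
move=> cK u0 y Ky; rewrite /partial.
rewrite (@near_eq_derive _ _ _ u (cst 0)) ?derive_cst//.
have : open (~` K) by exact: closed_openC.
rewrite openE => /(_ y Ky); apply: filterS => z Kz; exact: u0.
Qed.

Variables (phi : E -> R) (tphi : test_function phi).

Let K := closure [set y | phi y != 0].
Let cK : closed K. Proof. exact: closed_closure. Qed.
Let kK : compact K. Proof. by case: tphi. Qed.

Let phi0 y : ~ K y -> phi y = 0.
Proof.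
by move=> Ky; apply/eqP/negPn/negP => py; apply: Ky; exact: subset_closure.
Qed.

Let C2 : Ck 2 phi. Proof. by case: tphi. Qed.

Let cphi : continuous phi. Proof. by case: C2. Qed.
Let dphi i y : derivable phi y (delta_mx 0 i).
Proof. by have [_ /(_ i)[]] := C2. Qed.
Let cdphi i : continuous (partial i phi).
Proof. by have [_ /(_ i)[_ []]] := C2. Qed.
Let ddphi i y : derivable (partial i phi) y (delta_mx 0 i).
Proof. by have [_ /(_ i)[_ [_ /(_ i)[]]]] := C2. Qed.
Let cddphi i : continuous (partial i (partial i phi)).
Proof. by have [_ /(_ i)[_ [_ /(_ i)[]]]] := C2. Qed.

Let dphi0 i := partial_eq0 i cK phi0.
Let ddphi0 i := partial_eq0 i cK (@dphi0 i).

(** With g = e^{c + b |y|^2} this is the derivative along the i-th coordinate of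
    e^{-|y|^2/4} (g d_i phi - phi d_i g): note that
    e^{-|y|^2/4} g = gaussian c (b - 4^-1).  Summed over i it is the difference
    of the two integrands in drift_laplacian_gaussian. *)
Let flux c b i (y : E) := gaussian c (b - 4^-1) y *
  (partial i (partial i phi) y - 2^-1 * (y ord0 i * partial i phi y)
   - (2 * b + (4 * b ^+ 2 - b) * y ord0 i ^+ 2) * phi y).

Let continuous_flux c b i : continuous (flux c b i).
Proof.
apply: continuous_mul; first exact: continuous_gaussian.
apply: continuous_sub; first apply: continuous_sub => //.
- apply: continuous_mul; first exact: cst_continuous.
  by apply: continuous_mul => //; exact: continuous_coord.
- apply: continuous_mul => //; apply: continuous_add; first exact: cst_continuous.
  apply: continuous_mul; first exact: cst_continuous.
  by apply: (continuous_mul (f := fun y : E => y ord0 i)); exact: continuous_coord.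
Qed.

Let integral_flux c b i :
  (\int[lebesgue_rV R n]_y (flux c b i y)%:E = 0)%E.
Proof.
apply: (@integral_lines0 _ _ i).
  apply: compactly_supported_integrable; first exact: continuous_flux.
  by exists K => // y Ky; rewrite /flux phi0// dphi0// ddphi0// !mulr0 !subrr mulr0.
move=> y; have [B B0 KB] := compact_coord_bound kK.
have nK x : B <= `|x| -> ~ K (set_coord i x y).
  by move=> Bx /KB/(_ i); rewrite mxE eqxx ltNge Bx.
have sE x : set_coord i x y ord0 i = x by rewrite mxE eqxx.
(* The primitive of the flux along the line: its term 2 b x phi is phi d_i g / g. *)
pose F x := gaussian c (b - 4^-1) (set_coord i x y) *
  (partial i phi (set_coord i x y) - 2 * b * (x * phi (set_coord i x y))).
apply: (@integral_derive0 _ F _ B) => //.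
- move=> x; rewrite /F.
  have d1 := is_derive_line (@dphi i (set_coord i x y)).
  have d2 := is_derive_line (@ddphi i (set_coord i x y)).
  have d3 : is_derive x 1 (fun x => gaussian c (b - 4^-1) (set_coord i x y))
     ((b - 4^-1) * (2 * x) * gaussian c (b - 4^-1) (set_coord i x y)).
    rewrite /gaussian; under eq_fun do rewrite sqnorm_set_coord.
    rewrite sqnorm_set_coord.
    apply: is_derive_eq.
    rewrite /GRing.scale/=; ring.
  apply: is_derive_eq.
  by rewrite /flux /GRing.scale/= sE; field.
- move=> x; apply: (@continuous_comp _ _ _ (fun x => set_coord i x y) (flux c b i)).
    exact: continuous_set_coord.
  exact: continuous_flux.
- by move=> x /nK Kx; rewrite /F phi0// dphi0// !mulr0 subrr mulr0.
- by move=> x /nK Kx; rewrite /flux phi0// dphi0// ddphi0// !mulr0 !subrr mulr0.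
Qed.

Let sum_flux c b y : \sum_(i < n) flux c b i y =
  gaussian c (b - 4^-1) y * (drift_laplacian phi y
    - (2 * n%:R * b + (4 * b ^+ 2 - b) * sqnorm y) * phi y).
Proof.
rewrite /flux -mulr_sumr !sumrB -mulr_sumr -mulr_suml big_split/=.
rewrite sumr_const card_ord -mulr_sumr -/(sqnorm y) /drift_laplacian.
by rewrite -[_ *+ n]mulr_natr; ring.
Qed.

Let gaussian_density c b y :
  gaussian c b y * expR (- (potential y / 1)) = gaussian c (b - 4^-1) y.
Proof.
by rewrite /gaussian -expRD potentialE; congr expR; rewrite divr1; ring.
Qed.

(** Taken against Lebesgue measure, the integrands of the two sides differ by a
    divergence, the sum of the flux terms; this is the weak form of
    Delta_f g = (2 n b + (4 b^2 - b) |y|^2) g for g = e^{c + b |y|^2}. *)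
Lemma drift_laplacian_gaussian c b :
  (\int[weighted_measure 1]_y (gaussian c b y * drift_laplacian phi y)%:E =
   \int[weighted_measure 1]_y
     ((2 * n%:R * b + (4 * b ^+ 2 - b) * sqnorm y) * gaussian c b y * phi y)%:E)%E.
Proof.
have cp : continuous (fun y : E => 2 * n%:R * b + (4 * b ^+ 2 - b) * sqnorm y).
  apply: continuous_add; first exact: cst_continuous.
  by apply: continuous_mul; [exact: cst_continuous|exact: continuous_sqnorm].
have cr d : continuous (fun y : E =>
    (2 * n%:R * b + (4 * b ^+ 2 - b) * sqnorm y) * gaussian c d y * phi y).
  apply: continuous_mul => //; apply: continuous_mul => //.
  exact: continuous_gaussian.
have cd : continuous (drift_laplacian phi).
  apply: continuous_sub.
    by apply: continuous_big => //; exact: add_continuous.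
  apply: continuous_mul; first exact: cst_continuous.
  apply: continuous_big => [|i _]; first exact: add_continuous.
  by apply: continuous_mul => //; exact: continuous_coord.
rewrite !integral_weighted; last 2 first.
- by apply: continuous_measurable_rV; exact: cr.
- apply: continuous_measurable_rV; apply: continuous_mul => //.
  exact: continuous_gaussian.
set d := b - 4^-1.
transitivity (\int[lebesgue_rV R n]_y
    (((2 * n%:R * b + (4 * b ^+ 2 - b) * sqnorm y) * gaussian c d y * phi y)%:E +
     \sum_(i < n) (flux c b i y)%:E))%E.
  apply: eq_integral => y _; rewrite sumEFin -EFinD sum_flux -/d.
  by rewrite mulrAC gaussian_density -/d; congr EFin; ring.
have iflux i : (lebesgue_rV R n).-integrable [set: E] (EFin \o flux c b i).
  apply: compactly_supported_integrable; first exact: continuous_flux.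
  by exists K => // y Ky; rewrite /flux phi0// dphi0// ddphi0// !mulr0 !subrr mulr0.
rewrite integralD//; last 2 first.
- apply: (@compactly_supported_integrable _ _ (fun y => _ * gaussian c d y * phi y)); first exact: cr.
  by exists K => // y Ky; rewrite phi0// mulr0.
- by apply: (@integrable_sum _ _ _ _ _ measurableT _ _ _ (fun i y => (flux c b i y)%:E)) => i _; exact: iflux.
rewrite integral_sum// big1 ?adde0; last by move=> i _; exact: integral_flux.
by apply: eq_integral => y _; rewrite /d -gaussian_density; congr EFin; ring.
Qed.

End gaussian.

(** * The evolution of a Gaussian *)

Section taylor.
Variable R : realType.
Implicit Types f : R -> R.

Lemma le_mean_value f f1 (M s h : R) : 0 <= h ->
  (forall t, s <= t -> is_derive t (1 : R) f (f1 t)) ->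
  (forall t, s <= t -> `|f1 t| <= M) -> `|f (s + h) - f s| <= h * M.
Proof.
move=> h0 df fM.
have [|||t /andP[st _] ->] := @MVT_segment _ f f1 s (s + h).
- by rewrite lerDl.
- by move=> t /andP[/ltW st _]; exact: df.
- apply: derivable_within_continuous => t /andP[st _].
  by have [] := df t st.
by rewrite addrAC subrr add0r normrM (ger0_norm h0) mulrC ler_wpM2l// fM.
Qed.

Lemma le_taylor2 f f1 f2 (M s h : R) : 0 <= h ->
  (forall t, s <= t -> is_derive t (1 : R) f (f1 t)) ->
  (forall t, s <= t -> is_derive t (1 : R) f1 (f2 t)) ->
  (forall t, s <= t -> `|f2 t| <= M) ->
  `|f (s + h) - f s - h * f1 s| <= h ^+ 2 * M.
Proof.
move=> h0 df df1 fM.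
have [|||t /andP[st tsh] ->] := @MVT_segment _ f f1 s (s + h).
- by rewrite lerDl.
- by move=> t /andP[/ltW st _]; exact: df.
- apply: derivable_within_continuous => t /andP[st _].
  by have [] := df t st.
have M0 : 0 <= M by exact: le_trans (normr_ge0 _) (fM s (lexx s)).
rewrite addrAC subrr add0r mulrC -mulrBr normrM (ger0_norm h0) expr2 -mulrA.
rewrite ler_wpM2l//.
have ts0 : 0 <= t - s by rewrite subr_ge0.
have := le_mean_value ts0 df1 fM; rewrite (addrC s) subrK => /le_trans; apply.
by rewrite ler_wpM2r// lerBlDl.
Qed.

End taylor.

Section evolution.
Variables (R : realType) (n : nat) (b0 : R).
Hypotheses (b0_gt0 : 0 < b0) (b0_lt8 : b0 < 8^-1).

(** The solution of b' = 4 b^2 - b, c' = 2 n b with b(0) = b0 and c(0) = 0, found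
    from the linear equation satisfied by 1 / b. *)
Definition evolution_den (t : R) : R := 1 - 4 * b0 + 4 * b0 * expR (- t).
Definition evolution_rate (t : R) : R := b0 * expR (- t) / evolution_den t.
Definition evolution_const (t : R) : R := - (n%:R / 2) * ln (evolution_den t).

Local Notation q := evolution_den.
Local Notation b := evolution_rate.
Local Notation c := evolution_const.

Lemma evolution_den_gt t : 1 - 4 * b0 < q t.
Proof.
have b00 := b0_gt0; have b08 := b0_lt8.
by rewrite ltrDl mulr_gt0 ?expR_gt0//; lra. Qed.

Lemma evolution_den_gt0 t : 0 < q t.
Proof.
have b00 := b0_gt0; have b08 := b0_lt8.
by apply: lt_trans (evolution_den_gt t); lra. Qed.

Lemma evolution_rate_gt0 t : 0 < b t.
Proof.
have b00 := b0_gt0; have b08 := b0_lt8.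
rewrite divr_gt0 ?evolution_den_gt0// mulr_gt0 ?expR_gt0//; lra.
Qed.

Lemma evolution_rate_le t : 0 <= t -> b t <= b0.
Proof.
have b00 := b0_gt0; have b08 := b0_lt8.
move=> t0; rewrite ler_pdivrMr ?evolution_den_gt0// ler_pM2l; last by lra.
have e1 : expR (- t) <= 1 by rewrite -expR0 ler_expR oppr_le0.
have e0 := expR_gt0 (- t).
rewrite /q; nra.
Qed.

Lemma evolution_den0 : q 0 = 1.
Proof. by rewrite /evolution_den oppr0 expR0; ring. Qed.

Lemma evolution_rate0 : b 0 = b0.
Proof. by rewrite /evolution_rate evolution_den0 oppr0 expR0 mulr1 divr1. Qed.

Lemma evolution_const0 : c 0 = 0.
Proof. by rewrite /evolution_const evolution_den0 ln1 mulr0. Qed.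

Lemma is_derive_evolution_den t : is_derive t (1 : R) q (- (4 * b0 * expR (- t))).
Proof.
rewrite /evolution_den; apply: is_derive_eq.
by rewrite /GRing.scale/=; ring.
Qed.

Lemma is_derive_evolution_rate t :
  is_derive t (1 : R) b (4 * b t ^+ 2 - b t).
Proof.
have dq := is_derive_evolution_den t.
have q0 : q t != 0 by rewrite gt_eqF ?evolution_den_gt0.
have dqV := is_deriveV q0 dq.
rewrite /evolution_rate; apply: is_derive_eq.
rewrite /GRing.scale/= -exprVn; field.
exact: q0.
Qed.

Lemma is_derive_evolution_const t :
  is_derive t (1 : R) c (2 * n%:R * b t).
Proof.
have dq := is_derive_evolution_den t.
have dl : is_derive t (1 : R) (fun t => ln (q t)) (- (4 * b0 * expR (- t)) / q t).
  have dln := is_derive1_ln (evolution_den_gt0 t).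
  apply: is_derive_eq; by rewrite mulrC.
rewrite /evolution_const; apply: is_derive_eq.
rewrite /GRing.scale/= /evolution_rate; field.
by rewrite gt_eqF ?evolution_den_gt0.
Qed.

Definition evolution_max : R := - (n%:R / 2) * ln (1 - 4 * b0).

Lemma evolution_const_le t : c t <= evolution_max.
Proof.
have b00 := b0_gt0; have b08 := b0_lt8.
rewrite /evolution_const /evolution_max !mulNr lerN2 ler_wpM2l//.
by rewrite ler_ln ?posrE ?evolution_den_gt0 ?ltW ?evolution_den_gt//; lra.
Qed.

(** With x = b(t) and r = |y|^2, these are the factors by which the first and the
    second derivative in t multiply e^{c(t) + b(t) r}. *)
Definition growth (x r : R) : R := 2 * n%:R * x + (4 * x ^+ 2 - x) * r.
Definition growth2 (x r : R) : R :=
  (2 * n%:R + (8 * x - 1) * r) * (4 * x ^+ 2 - x) + growth x r ^+ 2.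

Let g r t := expR (c t + b t * r).

Lemma is_derive_profile r t :
  is_derive t (1 : R) (g r) (growth (b t) r * g r t).
Proof.
have dc := is_derive_evolution_const t; have db := is_derive_evolution_rate t.
rewrite /g; apply: is_derive_eq.
by rewrite /GRing.scale/= /growth; ring.
Qed.

Lemma is_derive_profile2 r t :
  is_derive t (1 : R) (fun t => growth (b t) r * g r t) (growth2 (b t) r * g r t).
Proof.
have dg := is_derive_profile r t; have db := is_derive_evolution_rate t.
rewrite /growth; apply: is_derive_eq.
by rewrite /GRing.scale/= /growth2 /growth; ring.
Qed.

(** Half-way between b0 and 1/8: e^{evolution_cap |y|^2} is still square integrable
    for e^{-|y|^2/4} dy, and the room left above b0 absorbs the polynomials in
    |y|^2 produced by differentiation in time. *)
Definition evolution_cap : R := (b0 + 8^-1) / 2.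
Definition evolution_bound : R :=
  2 * (1 + n%:R + 2 / (8^-1 - b0) * 2) ^+ 2 * expR evolution_max.

(** For 0 < b(t) <= 1/8 the two factors are at most 2 (1 + n + r)^2 in absolute
    value, and 1 + n + r <= k e^{(1/8 - b0) r / 4} for a suitable constant k because
    e^x >= 1 + x. *)
Lemma profile_bounds r t : 0 <= r -> 0 <= t ->
  `|growth (b t) r * g r t| <= evolution_bound * expR (evolution_cap * r) /\
  `|growth2 (b t) r * g r t| <= evolution_bound * expR (evolution_cap * r).
Proof.
have b00 := b0_gt0; have b08 := b0_lt8.
move=> r0 t0; have bp := evolution_rate_gt0 t; have bb := evolution_rate_le t0.
have n0 : 0 <= n%:R :> R by [].
have [x xE] : exists x, x = b t by exists (b t).
rewrite -xE in bp bb *.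
have x8 : x < 8^-1 by lra.
have hx : `|4 * x ^+ 2 - x| <= 8^-1 by rewrite ler_norml; apply/andP; split; nra.
set k := 1 + n%:R + 2 / (8^-1 - b0) * 2.
have A : `|growth x r| <= n%:R + r.
  apply: (le_trans (ler_normD _ _)); rewrite !normrM (ger0_norm r0) (ger0_norm n0).
  by rewrite (ger0_norm (ltW bp)) ger0_norm//; nra.
have A1 : `|(2 * n%:R + (8 * x - 1) * r) * (4 * x ^+ 2 - x)| <= n%:R + r.
  rewrite normrM.
  have : `|2 * n%:R + (8 * x - 1) * r| <= 2 * n%:R + r.
    by rewrite ler_norml; apply/andP; split; nra.
  have := normr_ge0 (2 * n%:R + (8 * x - 1) * r); nra.
have B : `|growth2 x r| <= (n%:R + r) + (n%:R + r) ^+ 2.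
  apply: (le_trans (ler_normD _ _)); apply: lerD => //.
  by rewrite normrX ler_pXn2r// nnegrE addr_ge0.
have d0 : 0 < 8^-1 - b0 by lra.
have gk : 1 + n%:R + r <= k * expR ((8^-1 - b0) / 4 * r).
  have := expR_ge1Dx ((8^-1 - b0) / 4 * r).
  have dV : (8^-1 - b0) / 4 * (2 / (8^-1 - b0) * 2) = 1 by field; lra.
  have kp : 0 <= 2 / (8^-1 - b0) * 2 by rewrite mulr_ge0// divr_ge0// ltW.
  have k0 : 0 <= k by rewrite /k; lra.
  move=> /(ler_wpM2l k0); apply: le_trans.
  have : 0 <= (1 + n%:R) * ((8^-1 - b0) / 4 * r).
    by rewrite mulr_ge0 ?mulr_ge0//; lra.
  have : (2 / (8^-1 - b0) * 2) * ((8^-1 - b0) / 4 * r) = r.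
    by rewrite mulrA (mulrC (_ * 2)) dV mul1r.
  rewrite /k; lra.
have gk2 : (1 + n%:R + r) ^+ 2 <= k ^+ 2 * expR ((8^-1 - b0) / 2 * r).
  have -> : (8^-1 - b0) / 2 * r = (8^-1 - b0) / 4 * r + (8^-1 - b0) / 4 * r by field.
  rewrite expRD -[_ * expR _]expr2 -exprMn ler_pXn2r// nnegrE.
    by lra.
  by apply: le_trans gk; lra.
have gle : g r t <= expR evolution_max * expR (b0 * r).
  by rewrite -expRD ler_expR lerD ?evolution_const_le// -xE ler_wpM2r.
have g0 : 0 <= g r t by exact: expR_ge0.
have key z : z <= 2 * (1 + n%:R + r) ^+ 2 -> z * g r t <=
    evolution_bound * expR (evolution_cap * r).
  move=> zk; apply: (@le_trans _ _ (2 * (1 + n%:R + r) ^+ 2 * (expR evolution_max * expR (b0 * r)))).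
    apply: (@le_trans _ _ (2 * (1 + n%:R + r) ^+ 2 * g r t)); first by rewrite ler_wpM2r.
    by rewrite ler_wpM2l//; apply: mulr_ge0; rewrite ?sqr_ge0.
  have -> : evolution_cap * r = (8^-1 - b0) / 2 * r + b0 * r.
    by rewrite /evolution_cap; field.
  rewrite expRD /evolution_bound -/k.
  have -> : 2 * k ^+ 2 * expR evolution_max * (expR ((8^-1 - b0) / 2 * r) * expR (b0 * r))
    = 2 * (k ^+ 2 * expR ((8^-1 - b0) / 2 * r)) * (expR evolution_max * expR (b0 * r)) by ring.
  by rewrite ler_wpM2r ?mulr_ge0 ?expR_ge0// ler_wpM2l.
by split; rewrite normrM (ger0_norm g0); apply: key; nra.
Qed.

Lemma profile_lipschitz r s h : 0 <= r -> 0 <= s -> 0 <= h ->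
  `|g r (s + h) - g r s| <= h * (evolution_bound * expR (evolution_cap * r)).
Proof.
move=> r0 s0 h0.
have dg t (_ : s <= t) := is_derive_profile r t.
have bound t (st : s <= t) := (profile_bounds r0 (le_trans s0 st)).1.
exact: (le_mean_value h0 dg bound).
Qed.

Lemma profile_taylor r s h : 0 <= r -> 0 <= s -> 0 <= h ->
  `|g r (s + h) - g r s - h * (growth (b s) r * g r s)| <=
  h ^+ 2 * (evolution_bound * expR (evolution_cap * r)).
Proof.
move=> r0 s0 h0.
have dg t (_ : s <= t) := is_derive_profile r t.
have dg2 t (_ : s <= t) := is_derive_profile2 r t.
have bound t (st : s <= t) := (profile_bounds r0 (le_trans s0 st)).2.
exact: (le_taylor2 h0 dg dg2 bound).
Qed.

End evolution.

(** * Gaussians in the weighted L2 spaces *)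

Section gaussian_L2.
Variables (R : realType) (n : nat).
Local Notation E := 'rV[R]_n.

Lemma sqrt_expR (x : R) : Num.sqrt (expR x) = expR (x / 2).
Proof.
have -> : expR x = expR (x / 2) ^+ 2 by rewrite expr2 -expRD; congr expR; field.
by rewrite sqrtr_sqr gtr0_norm ?expR_gt0.
Qed.

(** The squared norm is e^{2c} times the integral of e^{-a |y|^2}, with
    a = 1 / (4 s) - 2 b.  It is recorded in exponential form so that the later
    comparisons become linear in the exponents. *)
Lemma L2norm_gaussian (s c b : R) : 0 < (4 * s)^-1 - 2 * b ->
  L2norm s (@gaussian R n c b) =
  (expR (c + n%:R / 4 * ln (pi / ((4 * s)^-1 - 2 * b))))%:E.
Proof.
move=> a0; set a := _ - _ in a0 *.
have X0 : 0 < pi / a :> R by rewrite divr_gt0 ?pi_gt0.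
rewrite /L2norm Lnorm2E ge0_integral_weighted; last 2 first.
- by move=> y; rewrite lee_fin sqr_ge0.
- by apply/measurable_EFinP/measurable_funX; exact: measurable_gaussian.
transitivity ((\int[lebesgue_rV R n]_y
    ((expR (2 * c))%:E * (expR (- (a * sqnorm y)))%:E)) `^ 2^-1)%E.
  congr (_ `^ _)%E; apply: eq_integral => y _; rewrite -!EFinM; congr EFin.
  rewrite /gaussian potentialE expr2 -!expRD; congr expR.
  by rewrite /a invfM; ring.
rewrite (ge0_integralZl _ measurableT (@measurable_gauss _ n a)); last 2 first.
- by move=> y _; rewrite lee_fin expR_ge0.
- by rewrite lee_fin expR_ge0.
rewrite integral_gauss_rV// -EFinM poweR_EFin; congr EFin.
rewrite -[pi / a]lnK ?posrE// sqrt_expR -expRM_natl -expRD.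
by rewrite powR12_sqrt ?expR_ge0// sqrt_expR expRK; congr expR; field.
Qed.

Lemma mem_gaussian (c b : R) : b < 8^-1 ->
  @gaussian R n c b \in Lfun (weighted_measure 1) 2%:R%:E.
Proof.
move=> b8; apply: mem_Lfun2; first exact: measurable_gaussian.
have := @L2norm_gaussian 1 c b; rewrite /L2norm mulr1 => ->; first exact: ltry.
lra.
Qed.

End gaussian_L2.

Section domination.
Variables (d : measure_display) (T : measurableType d) (R : realType).
Variable mu : {measure set T -> \bar R}.
Local Notation L := (LfunType mu (@lee1n R 2)).

Lemma Lnorm2_dominated (f : T -> R) (g : L) (C : R) : 0 <= C ->
  measurable_fun [set: T] f -> (forall x, `|f x| <= C * `|g x|) ->
  ('N[mu]_2%:E[EFin \o f] <= (C * L2nm g)%:E)%E.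
Proof.
move=> C0 mf fg; rewrite Lnorm2_le ?mulr_ge0 ?L2nm_ge0//.
have mg : measurable_fun [set: T] g by [].
rewrite exprMn EFinM.
have -> : ((L2nm g ^+ 2)%:E = \int[mu]_x (g x ^+ 2)%:E)%E.
  by rewrite -Lnorm2_sqr -L2nmE poweR_EFin powR_mulrn// L2nm_ge0.
rewrite -ge0_integralZl//; last 3 first.
- by apply/measurable_EFinP/measurable_funX.
- by move=> x _; rewrite lee_fin sqr_ge0.
- by rewrite lee_fin sqr_ge0.
apply: ge0_le_integral => //.
- by move=> x _; rewrite lee_fin sqr_ge0.
- by apply/measurable_EFinP/measurable_funX.
- by apply/measurable_EFinP/measurable_funM => //; exact: measurable_funX.
- move=> x _; rewrite -EFinM lee_fin -exprMn -[leLHS]real_normK ?num_real//.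
  rewrite -[leRHS]real_normK ?num_real// normrM (ger0_norm C0).
  by rewrite ler_pXn2r// nnegrE// mulr_ge0.
Qed.

Lemma mem_Lfun2_dominated (f : T -> R) (g : L) (C : R) : 0 <= C ->
  measurable_fun [set: T] f -> (forall x, `|f x| <= C * `|g x|) ->
  f \in Lfun mu 2%:R%:E.
Proof.
move=> C0 mf fg; apply: mem_Lfun2 => //.
by apply: le_lt_trans (Lnorm2_dominated C0 mf fg) _; exact: ltry.
Qed.

Lemma L2nm_dominated (f g : L) (C : R) : 0 <= C ->
  (forall x, `|f x| <= C * `|g x|) -> L2nm f <= C * L2nm g.
Proof. by move=> C0 fg; rewrite -lee_fin L2nmE Lnorm2_dominated. Qed.

End domination.

Section change_of_weight.
Variables (R : realType) (n : nat).
Local Notation E := 'rV[R]_n.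

(** All the weighted measures have the null sets of Lebesgue measure, because their
    densities are positive.  This allows one to identify P_t v for one weight and to
    compute its norm for another. *)
Lemma eq_L2norm_weight (s t : R) (u v : E -> R) :
  measurable_fun [set: E] u -> measurable_fun [set: E] v ->
  L2norm s (u \- v) = 0%E -> L2norm t u = L2norm t v.
Proof.
move=> mu_ mv; rewrite /L2norm => uv0.
have muv : measurable_fun [set: E] (fun y => ((u y - v y) ^+ 2)%:E).
  by apply/measurable_EFinP/measurable_funX/measurable_funB.
have mw r : measurable_fun [set: E] (fun y : E => (expR (- (potential y / r)))%:E).
  apply/measurable_EFinP/measurableT_comp => //; apply: measurableT_comp => //.
  by apply: measurable_funM => //; exact: measurable_potential.
have : (\int[weighted_measure s]_y ((u y - v y) ^+ 2)%:E = 0)%E.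
  by rewrite -(Lnorm2_sqr _ (u \- v)) uv0 poweR0r.
rewrite ge0_integral_weighted//; last by move=> y; rewrite lee_fin sqr_ge0.
set F := (fun y => _ * _)%E => F0.
have mF : measurable_fun [set: E] F by apply: emeasurable_funM.
have Fae : ae_eq (lebesgue_rV R n) setT F (cst 0).
  apply/ae_eq_integral_abs => //; rewrite -[RHS]F0.
  by apply: eq_integral => y _; rewrite gee0_abs// mule_ge0// lee_fin ?sqr_ge0 ?expR_ge0.
rewrite !Lnorm2E; congr (_ `^ _)%E.
rewrite !ge0_integral_weighted; [|by move=> y; rewrite lee_fin sqr_ge0|
  by apply/measurable_EFinP/measurable_funX|by move=> y; rewrite lee_fin sqr_ge0|
  by apply/measurable_EFinP/measurable_funX].
apply: ge0_ae_eq_integral => //.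
- by apply: emeasurable_funM => //; apply/measurable_EFinP/measurable_funX.
- by apply: emeasurable_funM => //; apply/measurable_EFinP/measurable_funX.
- by move=> y _; rewrite mule_ge0// lee_fin ?sqr_ge0 ?expR_ge0.
- by move=> y _; rewrite mule_ge0// lee_fin ?sqr_ge0 ?expR_ge0.
- apply: filterS Fae => y /(_ I); rewrite /F -EFinM => -[] /eqP.
  rewrite mulf_eq0 (gt_eqF (expR_gt0 _)) orbF sqrf_eq0 subr_eq0 => /eqP uv _.
  by rewrite uv.
Qed.

End change_of_weight.

(** * The semigroup applied to a Gaussian *)

Section drift_heat_semigroup_seminorm.
Variables (R : realType) (n : nat) (P : R -> L2 R n -> L2 R n).

Lemma cvg_L2nm (F : R -> L2 R n) :
  L2norm 1 (F h) @[h --> 0^'+] --> 0%E -> L2nm (F h) @[h --> 0^'+] --> 0.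
Proof. by move=> F0; apply: fine_cvg. Qed.

Lemma L2nm_eq0 (u : L2 R n) : L2norm 1 u = 0%E -> L2nm u = 0.
Proof. by rewrite /L2norm /L2nm => ->. Qed.

Lemma C0_semigroup_mod : is_C0_semigroup P ->
  is_semigroup_mod (@L2nm _ _ _ (weighted_measure 1)) P.
Proof.
case=> Plin Pbd Pid Padd Pcont; split.
- by move=> t t0 a u v; apply/L2nm_eq0/Plin.
- move=> t t0; have [C HC] := Pbd t t0; exists C => u.
  by rewrite -lee_fin EFinM !L2nmE; exact: HC.
- by move=> u; apply/L2nm_eq0/Pid.
- by move=> s t s0 t0 u; apply/L2nm_eq0/Padd.
- by move=> u; apply/cvg_L2nm/Pcont.
Qed.

End drift_heat_semigroup_seminorm.

Section gaussian_evolution.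
Variables (R : realType) (n : nat) (b0 : R).
Hypotheses (b0_gt0 : 0 < b0) (b0_lt8 : b0 < 8^-1).
Variables (P : R -> L2 R n -> L2 R n) (hP : drift_heat_semigroup P).
Local Notation E := 'rV[R]_n.
Local Notation b := (evolution_rate b0).
Local Notation c := (evolution_const n b0).
Local Notation N := (@L2nm _ _ _ (@weighted_measure R n 1)).

Let rate_lt8 t : 0 <= t -> b t < 8^-1.
Proof. by move=> t0; apply: le_lt_trans b0_lt8; exact: evolution_rate_le. Qed.

Let cap_lt8 : evolution_cap b0 < 8^-1.
Proof. have b08 := b0_lt8; rewrite /evolution_cap; lra. Qed.

Let Gam : L2 R n := Lfun_Sub (@lee1n R 2) (@mem_gaussian R n 0 _ cap_lt8).

Let M := evolution_bound n b0.
Let M0 : 0 <= M.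
Proof.
rewrite /M /evolution_bound mulr_ge0 ?expR_ge0//; apply: mulr_ge0 => //.
exact: sqr_ge0.
Qed.

Let GamE (y : E) : `|Gam y| = expR (evolution_cap b0 * sqnorm y).
Proof. by rewrite /= /gaussian add0r gtr0_norm ?expR_gt0. Qed.

Let w t (y : E) := growth n (b t) (sqnorm y) * gaussian (c t) (b t) y.

Let mem_w t : 0 <= t -> w t \in Lfun (@weighted_measure R n 1) 2%:R%:E.
Proof.
move=> t0; apply: (mem_Lfun2_dominated (g := Gam) M0).
  apply: measurable_funM; last exact: measurable_gaussian.
  by apply: measurable_funD => //; apply: measurable_funM => //; exact: measurable_sqnorm.
move=> y; rewrite GamE.
by have [] := profile_bounds n b0_gt0 b0_lt8 (sqnorm_ge0 y) t0.
Qed.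

(** Each profile lies in the domain of the generator by drift_laplacian_gaussian, and
    the bound profile_taylor, which is uniform in y up to the square integrable factor
    e^{evolution_cap |y|^2}, turns the pointwise derivative in t into a derivative
    in L2. *)
Theorem semigroup_gaussian (v : L2 R n) : v =1 gaussian 0 b0 ->
  forall t, 0 <= t ->
  L2norm 1 (P t v \- gaussian (c t) (b t)) = 0%E.
Proof.
move=> v0 t t0.
have /choice[g gE] s : exists g : L2 R n, 0 <= s -> g =1 gaussian (c s) (b s).
  have [s0|s0] := boolP (0 <= s); last by exists 0.
  by exists (Lfun_Sub (@lee1n R 2) (mem_gaussian n (c s) (rate_lt8 s0))).
have /choice[w' wE] s : exists g : L2 R n, 0 <= s -> g =1 w s.
  have [s0|s0] := boolP (0 <= s); last by exists 0.
  by exists (Lfun_Sub (@lee1n R 2) (mem_w s0)).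
have [C0P genP] := hP.
have gv : v = g 0.
  apply/LfuneqP => y.
  by rewrite (gE 0 (lexx 0)) evolution_const0 evolution_rate0; exact: v0.
suff NP : N (P t (g 0) - g t) = 0.
  rewrite gv; have := L2nmE (P t (g 0) - g t); rewrite NP => /esym NE.
  by apply: etrans NE; apply: eq_Lnorm => y /=; rewrite -gE.
apply: (semigroup_uniqueness (L2nm_seminorm _) (@L2_rapidly_complete _ _ _ _)
  (C0_semigroup_mod C0P) (w := w')) => //.
- move=> s s0; apply: cvg_L2nm; apply/genP => phi tphi.
  under eq_integral do rewrite gE//.
  rewrite drift_laplacian_gaussian//; apply: eq_integral => y _.
  by rewrite wE.
- move=> s s0; apply: (@cvg0_right_linear _ _ 1 (M * N Gam)) => // h /andP[h0 _].
  rewrite L2nm_ge0/= mulrA; apply: L2nm_dominated; first by rewrite mulr_ge0// ltW.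
  move=> y; rewrite GamE.
  have sh : 0 <= s + h by rewrite addr_ge0// ltW.
  have -> : (h^-1 *: (g (s + h) - g s) - w' s) y =
    h^-1 * (gaussian (c (s + h)) (b (s + h)) y - gaussian (c s) (b s) y - h * w s y).
    rewrite -!gE// -wE// mulrBr mulrA mulVf ?gt_eqF// mul1r//.
  rewrite normrM gtr0_norm ?invr_gt0// ler_pdivrMl// -[h * M * _]mulrA [leRHS]mulrA -expr2.
  exact: (profile_taylor n b0_gt0 b0_lt8 (sqnorm_ge0 y) s0 (ltW h0)).
- move=> s s0.
  apply: (@cvg0_right_linear _ _ s (M * N Gam)) => // h /andP[h0 hs].
  rewrite L2nm_ge0/= mulrA; apply: L2nm_dominated; first by rewrite mulr_ge0// ltW.
  move=> y; rewrite GamE.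
  have sh : 0 <= s - h by rewrite subr_ge0 ltW.
  have -> : (g s - g (s - h)) y =
    gaussian (c (s - h + h)) (b (s - h + h)) y - gaussian (c (s - h)) (b (s - h)) y.
    by rewrite -!gE ?subrK// ltW.
  rewrite -mulrA.
  exact: (profile_lipschitz n b0_gt0 b0_lt8 (sqnorm_ge0 y) sh (ltW h0)).
Qed.

End gaussian_evolution.

(** * The limit of the rescaled norms *)

Section limit.
Variables (R : realType) (n : nat) (b0 : R).
Hypotheses (b0_gt0 : 0 < b0) (b0_lt8 : b0 < 8^-1).
Local Notation b := (evolution_rate b0).
Local Notation c := (evolution_const n b0).

(** In terms of z = e^{-t}: the Gaussian |u_t|^2 e^{-|y|^2/(2(e^t + 1))} is
    e^{2 c(t)} e^{- a |y|^2} with a = z * width z.  The factor z is exactly what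
    the normalization e^{-nt/4} removes, and the rest is continuous at z = 0. *)
Definition width (z : R) : R :=
  (2 * (1 + z))^-1 - 2 * b0 / (1 - 4 * b0 + 4 * b0 * z).

Definition log_profile (z : R) : R :=
  - (n%:R / 2) * ln (1 - 4 * b0 + 4 * b0 * z) + n%:R / 4 * (ln pi - ln (width z)).

Let den_gt0 z : 0 <= z -> 0 < 1 - 4 * b0 + 4 * b0 * z.
Proof.
move=> z0; have b00 := b0_gt0; have b08 := b0_lt8.
have : 0 <= 4 * b0 * z by apply: mulr_ge0 => //; lra.
lra.
Qed.

Lemma width_gt0 z : 0 <= z -> 0 < width z.
Proof.
move=> z0; have b00 := b0_gt0; have b08 := b0_lt8; have d0 := den_gt0 z0.
rewrite subr_gt0 ltr_pdivrMr// [ltRHS]mulrC ltr_pdivlMr; last by lra.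
nra.
Qed.

Lemma continuous_log_profile : {for 0, continuous log_profile}.
Proof.
have b00 := b0_gt0; have b08 := b0_lt8.
have cden : {for 0, continuous (fun z : R => 1 - 4 * b0 + 4 * b0 * z)}.
  apply: cvgD; first exact: cvg_cst.
  by apply: cvgM; [exact: cvg_cst|exact: cvg_id].
have cwidth : {for 0, continuous width}.
  apply: cvgB.
    apply: cvgV; first by rewrite addr0 mulr1.
    apply: cvgM; first exact: cvg_cst.
    by apply: cvgD; [exact: cvg_cst|exact: cvg_id].
  apply: cvgM; first exact: cvg_cst.
  by apply: cvgV => //; rewrite gt_eqF// den_gt0.
apply: cvgD; apply: cvgM; try exact: cvg_cst.
  apply: (@continuous_comp _ _ _ (fun z : R => 1 - 4 * b0 + 4 * b0 * z) (@ln R)) => //.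
  by apply: continuous_ln; rewrite den_gt0.
apply: cvgB; first exact: cvg_cst.
apply: (@continuous_comp _ _ _ width (@ln R)) => //.
by apply: continuous_ln; rewrite width_gt0.
Qed.

Lemma scaled_L2norm_gaussian t : 0 <= t ->
  ((expR (- (n%:R * t / 4)))%:E *
   L2norm ((expR t + 1) / 2) (@gaussian R n (c t) (b t)))%E =
  (expR (log_profile (expR (- t))))%:E.
Proof.
move=> t0; have b00 := b0_gt0; have b08 := b0_lt8.
have et := expR_gt0 t; have ent := expR_gt0 (- t).
have q0 : 0 < evolution_den b0 t by exact: evolution_den_gt0.
have aE : (4 * ((expR t + 1) / 2))^-1 - 2 * b t = expR (- t) * width (expR (- t)).
  rewrite /evolution_rate /width -/(evolution_den b0 t) mulrBr; congr (_ - _); last by ring.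
  by rewrite expRN; field; rewrite ?gt_eqF//; lra.
have w0 := width_gt0 (ltW ent).
rewrite L2norm_gaussian aE; last by rewrite mulr_gt0.
rewrite -EFinM -expRD; congr (expR _)%:E.
rewrite ln_div ?posrE ?pi_gt0 ?mulr_gt0// lnM ?posrE// expRK.
by rewrite /evolution_const /log_profile /evolution_den; field.
Qed.

Lemma cvg_expRN : expR (- t) @[t --> +oo] --> (0 : R).
Proof. exact: cvgr_expR. Qed.

Lemma cvg_scaled_L2norm :
  (expR (log_profile (expR (- t))))%:E @[t --> +oo] --> (expR (log_profile 0))%:E.
Proof.
apply: cvg_EFin; first exact: nearW.
apply: (@cvg_comp _ _ _ (fun t => log_profile (expR (- t))) expR); last exact: continuous_expR.
apply: (@cvg_comp _ _ _ (fun t => expR (- t)) log_profile); first exact: cvg_expRN.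
exact: continuous_log_profile.
Qed.

(** The limit divided by the norm of the Gaussian is e^{-(n/4) ln(2(1 - 4 b0))}, and
    ln(2(1 - 4 b0)) = ln(1 + 8(1/8 - b0)) <= 8 (1/8 - b0). *)
Lemma limit_ratio :
  ((1 - n%:R * (8^-1 - b0) * 2)%:E * L2norm 1 (@gaussian R n 0 b0) <=
  (expR (log_profile 0))%:E)%E.
Proof.
have b00 := b0_gt0; have b08 := b0_lt8.
rewrite L2norm_gaussian ?mulr1; last by lra.
rewrite -EFinM lee_fin add0r.
apply: (@le_trans _ _ (expR (- (n%:R * (8^-1 - b0) * 2)) *
    expR (n%:R / 4 * ln (pi / (4^-1 - 2 * b0))))).
  by rewrite ler_wpM2r ?expR_ge0// (le_trans _ (expR_ge1Dx _)).
rewrite -expRD ler_expR /log_profile.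
have p0 : 0 < 1 - 4 * b0 by lra.
have a0 : 0 < 4^-1 - 2 * b0 by lra.
have -> : width 0 = (4^-1 - 2 * b0) * (2 / (1 - 4 * b0)).
  by rewrite /width mulr0 !addr0 mulr1; field; rewrite gt_eqF.
rewrite mulr0 addr0 ln_div ?posrE ?pi_gt0// lnM ?posrE ?divr_gt0// ln_div ?posrE//.
have l2 : ln 2 + ln (1 - 4 * b0) <= 8 * (8^-1 - b0).
  rewrite -lnM ?posrE//.
  have -> : 2 * (1 - 4 * b0) = 1 + 8 * (8^-1 - b0) by field.
  by apply: le_ln1Dx; lra.
have n0 : 0 <= n%:R / 4 :> R by rewrite divr_ge0.
have := ler_wpM2l n0 l2; lra.
Qed.

End limit.

Unset Implicit Arguments.

Theorem mainTheorem3 (R : realType) (n : nat) (hn : (1 <= n)%N)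
    (P : R -> L2 R n -> L2 R n) (hP : drift_heat_semigroup P)
    (eps : R) (heps : 0 < eps) :
  exists v : L2 R n, L2norm 1 v != 0%E /\
    exists l : R,
      ((expR (- (n%:R * t / 4)))%:E * L2norm ((expR t + 1) / 2) (P t v))%E
        @[t --> +oo] --> l%:E /\
      ((1 - eps)%:E * L2norm 1 v <= l%:E)%E.
Proof.
pose e := Num.min 1 eps.
have e0 : 0 < e by rewrite lt_min ltr01.
have e1 : e <= 1 by rewrite ge_min lexx.
have ee : e <= eps by rewrite ge_min lexx orbT.
have n1 : 1 <= n%:R :> R by rewrite ler1n.
have n0 : 0 < n%:R :> R by lra.
(* The ratio is at least 1 - 2 n (1/8 - b0), which is 1 - e / 8 for this choice;
   e <= 1 keeps b0 positive. *)
pose b0 : R := 8^-1 - e / (16 * n%:R).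
have d0 : 0 < e / (16 * n%:R) by rewrite divr_gt0// mulr_gt0.
have d1 : e / (16 * n%:R) <= 16^-1.
  rewrite ler_pdivrMr ?mulr_gt0// mulrA mulVf// mul1r; lra.
have b0_gt0 : 0 < b0 by rewrite /b0; lra.
have b0_lt8 : b0 < 8^-1 by rewrite /b0; lra.
have bE : n%:R * (8^-1 - b0) * 2 = e / 8.
  by rewrite /b0; field; rewrite gt_eqF.
pose v : L2 R n := Lfun_Sub (@lee1n R 2) (mem_gaussian n 0 b0_lt8).
have vnorm : L2norm 1 v = L2norm 1 (@gaussian R n 0 b0) by [].
exists v; split.
  by rewrite vnorm L2norm_gaussian ?eqe ?gt_eqF ?expR_gt0//; lra.
exists (expR (log_profile n b0 0)); split; last first.
  apply: le_trans (limit_ratio n b0_gt0 b0_lt8).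
  rewrite -vnorm bE; apply: lee_wpmul2r; first exact: Lnorm_ge0.
  by rewrite lee_fin; lra.
apply: cvg_trans (cvg_scaled_L2norm b0_gt0 b0_lt8).
apply: near_eq_cvg; near=> t.
have t0 : 0 <= t by near: t; exact: nbhs_pinfty_ge.
rewrite -scaled_L2norm_gaussian//; congr (_ * _)%E.
apply/esym/(@eq_L2norm_weight _ _ 1) => //; first exact: measurable_gaussian.
exact: semigroup_gaussian.
Unshelve. all: by end_near. Qed.
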